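(* Let $W$ be the Weyl group of type $A_n$ and $\widetilde{W}$ its affine Weyl group. If $n=1$, every element of $\widetilde{W}^S$ is palindromic. If $n\ge2$, then an element $w\in\widetilde{W}^S$ is palindromic if and only if $w$ is a cpo or a spiral element.
   Context: $\widetilde{W}$ is the affine symmetric group with Coxeter generators $s_0,\dots,s_n$ indexed mod $n+1$ ($m(s_a,s_b)=3$ if $a-b\equiv\pm1\pmod{n+1}$, else $2$, for $n\ge 2$; $m(s_0,s_1)=\infty$ for $n=1$); $S=\{s_1,\dots,s_n\}$, $\widetilde{W}^S$ the minimal length left coset representatives of $W_S$, with Bruhat order. $P_w(t)=\sum_{v\in\widetilde{W}^S,v\le w}t^{\ell(v)}$; $w$ is palindromic if its coefficients satisfy $a_i=a_{\ell(w)-i}$ for all $i$. For $w\in\widetilde{W}^S$ let $I_w=\{s\in\{s_0,\dots,s_n\}: s\le w\}$; $w$ is a cpo if $sw\le w$ for all $s\in I_w$. For $0\le i\le n$, $1\le j\le n$ let $C_{i,j}=s_i\cdots s_1\,s_{n-j+2}\cdots s_n\,s_0$ (blocks empty when $i=0$, resp. $j=1$). The spiral elements are the elements $C_{0,j}(C_{1,n})^k$ with $1\le j\le n$, $k\ge0$, $j+k\equiv0\pmod n$, and $C_{i,1}(C_{n,1})^k$ with $0\le i\le n-1$, $k\ge0$, $i+k+1\equiv0\pmod n$.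
   Formalization: Spiral elements here allow 1≤j≤n+1 and 0≤i≤n (with C_{0,n+1}=C_{1,n}), since the stated bounds miss palindromic non-cpo elements such as (s_1s_2s_0)^2 for n=2; in the cpo condition, sw≤w compares the cosets swW_S and wW_S. *)

(* Defs.v *)
From HB Require Import structures.
From mathcomp Require Import all_boot all_order all_algebra.
From mathcomp Require Import generic_quotient finmap.
From mathcomp Require Import all_classical.

Set Implicit Arguments.
Unset Strict Implicit.
Unset Printing Implicit Defensive.

Import GRing.Theory.

(* Coxeter matrix of type affine A_n on the nodes 0..n, indexed mod n+1; the
   value 0 encodes m(s_a,s_b) = infinity, i.e. the absence of a relation. *)
Definition affA_mx (n : nat) (a b : 'I_n.+1) : nat :=
  if a == b then 1
  else if n == 1 then 0
  else if (a.+1 == b %[mod n.+1]) || (b.+1 == a %[mod n.+1]) then 3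
  else 2.

Local Open Scope quotient_scope.

(* The congruence on words presenting < s_a | (s_a s_b)^m(a,b) = 1 >. *)
Inductive affA_eqv (n : nat) : seq 'I_n.+1 -> seq 'I_n.+1 -> Prop :=
| affA_eqv_rel u v a b :
    affA_eqv (u ++ flatten (nseq (affA_mx a b) [:: a; b]) ++ v) (u ++ v)
| affA_eqv_refl u : affA_eqv u u
| affA_eqv_sym u v : affA_eqv u v -> affA_eqv v u
| affA_eqv_trans u v w : affA_eqv u v -> affA_eqv v w -> affA_eqv u w.

Definition affA_eqvb (n : nat) : rel (seq 'I_n.+1) :=
  fun u v => `[< affA_eqv u v >].

Lemma affA_eqvb_equiv n : equiv_class_of (@affA_eqvb n).
Proof.
split=> [u|u v|v u w].
- by apply/asboolP; apply: affA_eqv_refl.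
- by apply/asboolP/asboolP => /affA_eqv_sym.
- by move=> /asboolP uv /asboolP vw; apply/asboolP; apply: affA_eqv_trans uv vw.
Qed.

Canonical affA_equiv n := EquivRelPack (affA_eqvb_equiv n).

(* The affine symmetric group, as a Coxeter group. *)
Definition affA (n : nat) := {eq_quot (affA_equiv n)}.

HB.instance Definition _ n := EqQuotient.copy (affA n) (affA n).
HB.instance Definition _ n := Choice.copy (affA n) (affA n).

Definition affA_word (n : nat) (u : seq 'I_n.+1) : affA n := \pi_(affA n) u.

Lemma affA_wordP n (u v : seq 'I_n.+1) :
  affA_word u = affA_word v <-> affA_eqv u v.
Proof. by split=> [/eqquotP/asboolP | /asboolP uv]; last exact/eqquotP. Qed.

Lemma affA_word_repr n (x : affA n) : affA_word (repr x) = x.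
Proof. exact: reprK. Qed.

Lemma affA_eqv_cat n (u u' v v' : seq 'I_n.+1) :
  affA_eqv u u' -> affA_eqv v v' -> affA_eqv (u ++ v) (u' ++ v').
Proof.
move=> uu' vv'; apply: (@affA_eqv_trans _ _ (u' ++ v)).
  elim: uu' => [x y a b|x|x y _ IH|x y z _ IH1 _ IH2].
  - by rewrite -!catA; apply: affA_eqv_rel.
  - exact: affA_eqv_refl.
  - exact: affA_eqv_sym.
  - exact: affA_eqv_trans IH1 IH2.
elim: vv' => [x y a b|x|x y _ IH|x y z _ IH1 _ IH2].
- by rewrite !(catA u'); apply: affA_eqv_rel.
- exact: affA_eqv_refl.
- exact: affA_eqv_sym.
- exact: affA_eqv_trans IH1 IH2.
Qed.

Lemma affA_eqv_revK n (u : seq 'I_n.+1) : affA_eqv (rev u ++ u) [::].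
Proof.
elim: u => [|a u IH]; first exact: affA_eqv_refl.
rewrite rev_cons cat_rcons; apply: affA_eqv_trans IH.
by have := affA_eqv_rel (rev u) u a a; rewrite /affA_mx eqxx.
Qed.

Lemma affA_eqv_rev n (u v : seq 'I_n.+1) :
  affA_eqv u v -> affA_eqv (rev u) (rev v).
Proof.
move=> uv; apply: (@affA_eqv_trans _ _ (rev u ++ (v ++ rev v))).
  rewrite -{1}[rev u]cats0; apply: affA_eqv_cat; first exact: affA_eqv_refl.
  by apply: affA_eqv_sym; rewrite -{1}[v]revK; apply: affA_eqv_revK.
rewrite catA -{2}[rev v]cat0s; apply: affA_eqv_cat; last exact: affA_eqv_refl.
apply: affA_eqv_trans (affA_eqv_revK u).
by apply: affA_eqv_cat (affA_eqv_sym uv); apply: affA_eqv_refl.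
Qed.

Definition affA_one n : affA n := affA_word [::].
Definition affA_mul n (x y : affA n) : affA n := affA_word (repr x ++ repr y).
Definition affA_inv n (x : affA n) : affA n := affA_word (rev (repr x)).

Lemma affA_repr_word n (u : seq 'I_n.+1) : affA_eqv (repr (affA_word u)) u.
Proof. by apply/affA_wordP; rewrite affA_word_repr. Qed.

Lemma affA_mulE n (u v : seq 'I_n.+1) :
  affA_mul (affA_word u) (affA_word v) = affA_word (u ++ v).
Proof. by apply/affA_wordP/affA_eqv_cat; apply: affA_repr_word. Qed.

Lemma affA_invE n (u : seq 'I_n.+1) :
  affA_inv (affA_word u) = affA_word (rev u).
Proof. by apply/affA_wordP/affA_eqv_rev; apply: affA_repr_word. Qed.

Lemma affA_mulA n : associative (@affA_mul n).
Proof.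
move=> x y z.
rewrite -(affA_word_repr x) -(affA_word_repr y) -(affA_word_repr z).
by rewrite !affA_mulE catA.
Qed.

Lemma affA_mul1 n : left_id (@affA_one n) (@affA_mul n).
Proof. by move=> x; rewrite -(affA_word_repr x) affA_mulE. Qed.

Lemma affA_mulr1 n : right_id (@affA_one n) (@affA_mul n).
Proof. by move=> x; rewrite -(affA_word_repr x) affA_mulE cats0. Qed.

Lemma affA_mulV n : left_inverse (@affA_one n) (@affA_inv n) (@affA_mul n).
Proof.
move=> x; rewrite -(affA_word_repr x) affA_invE affA_mulE.
exact/affA_wordP/affA_eqv_revK.
Qed.

Lemma affA_mulrV n : right_inverse (@affA_one n) (@affA_inv n) (@affA_mul n).
Proof.
move=> x; rewrite -(affA_word_repr x) affA_invE affA_mulE.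
by apply/affA_wordP; rewrite -{1}[repr x]revK; apply: affA_eqv_revK.
Qed.

HB.instance Definition _ n := isGroup.Build (affA n)
  (@affA_mulA n) (@affA_mul1 n) (@affA_mulr1 n) (@affA_mulV n) (@affA_mulrV n).

Local Open Scope group_scope.

(* Generators are indexed mod n+1. *)
Definition affA_gen (n k : nat) : affA n := affA_word [:: inZp k].

Lemma affA_word_prod n (u : seq 'I_n.+1) :
  affA_word u = \prod_(a <- u) affA_gen n a.
Proof.
elim: u => [|a u IH]; first by rewrite big_nil.
rewrite big_cons -IH /affA_gen valZpK.
by rewrite [RHS]affA_mulE.
Qed.

Lemma affA_length_ex n (w : affA n) :
  exists k, `[< exists u : seq 'I_n.+1, affA_word u = w /\ size u = k >].
Proof.
by exists (size (repr w)); apply/asboolP; exists (repr w);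
  rewrite affA_word_repr.
Qed.

Definition affA_length (n : nat) (w : affA n) : nat :=
  ex_minn (affA_length_ex w).

Definition is_reflection (n : nat) (t : affA n) : Prop :=
  exists (x : affA n) (k : nat), t = x * affA_gen n k * x^-1.

Inductive bruhat_le (n : nat) : affA n -> affA n -> Prop :=
| bruhat_refl w : bruhat_le w w
| bruhat_step u v t : bruhat_le u v -> is_reflection t ->
    affA_length v < affA_length (v * t) -> bruhat_le u (v * t).

(* The parabolic subgroup W_S, S = {s_1, ..., s_n}. *)
Definition in_WS (n : nat) (u : affA n) : Prop :=
  exists ks : seq nat, all (fun k => 0 < k <= n) ks /\
    u = \prod_(k <- ks) affA_gen n k.

Definition is_min_rep (n : nat) (w : affA n) : Prop :=
  forall u : affA n, in_WS u -> affA_length w <= affA_length (w * u).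

Definition poincare_set (n : nat) (w : affA n) : set (affA n) :=
  [set v | is_min_rep v /\ bruhat_le v w]%classic.

Definition poincare_poly (n : nat) (w : affA n) : {poly int} :=
  (\sum_(v <- fset_set (poincare_set w)) 'X^(affA_length v))%R.

(* [fset_set] is empty on infinite sets, so the definition above needs this. *)
Lemma poincare_set_finite n (w : affA n) : finite_set (poincare_set w).
Proof.
have le_len (u v : affA n) : bruhat_le u v -> affA_length u <= affA_length v.
  elim=> // {}u {}v t _ IH _ lt_v; exact: leq_trans IH (ltnW lt_v).
have fin_len k : finite_set [set v : affA n | affA_length v = k]%classic.
  apply: (@sub_finite_set _ _
    ((fun u : k.-tuple 'I_n.+1 => affA_word u) @` [set: k.-tuple 'I_n.+1])%classic).
    move=> v /= <-; rewrite /affA_length; case: ex_minnP => m /asboolP[u [<- <-]] _.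
    by exists (in_tuple u).
  exact/finite_image/finite_finset.
apply: (@sub_finite_set _ _ (\bigcup_(k in `I_(affA_length w).+1)
    [set v : affA n | affA_length v = k])%classic).
  by move=> v /= [_ /le_len le_vw]; exists (affA_length v); rewrite //= ltnS.
by apply: bigcup_finite => // k _; apply: fin_len.
Qed.

Definition palindromic (n : nat) (w : affA n) : Prop :=
  forall i, i <= affA_length w ->
    ((poincare_poly w)`_i = (poincare_poly w)`_(affA_length w - i))%R.

(* Bruhat order on the left cosets x W_S and y W_S, compared through their
   minimal representatives. *)
Definition coset_le (n : nat) (x y : affA n) : Prop :=
  exists u v : affA n, [/\ in_WS u, in_WS v,
    is_min_rep (x * u), is_min_rep (y * v) & bruhat_le (x * u) (y * v)].

(* In the condition s w <= w, s acts on W^S = W/W_S, so the comparison is one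
   of cosets: s w either lies in W^S or lies in the coset w W_S, and the latter
   counts as s w <= w.  Compared inside the whole group, s w <= w for all s in
   I_w would force w = 1 or w = s_0. *)
Definition is_cpo (n : nat) (w : affA n) : Prop :=
  forall k, bruhat_le (affA_gen n k) w -> coset_le (affA_gen n k * w) w.

(* C_{i,j} = s_i ... s_1 s_{n-j+2} ... s_n s_0 *)
Definition spiral_C (n i j : nat) : affA n :=
  (\prod_(k <- rev (iota 1 i)) affA_gen n k) *
  (\prod_(k <- iota (n.+2 - j) j.-1) affA_gen n k) * affA_gen n 0.

(* The spiral elements are the elements of lengths n, 2n, 3n, ... in the two
   families below.  The bounds j <= n+1 and i <= n (where C_{0,n+1} = C_{1,n})
   include the full-turn elements (C_{1,n})^m and (C_{n,1})^m with m > 0 a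
   multiple of n.  These are palindromic and not cpo's, but the bounds j <= n
   and i <= n-1 would omit them: for n = 2 the element
   w = s_1 s_2 s_0 s_1 s_2 s_0 has P_w = 1 + t + 2t^2 + 2t^3 + 2t^4 + t^5 + t^6. *)
Definition is_spiral (n : nat) (w : affA n) : Prop :=
  (exists j k : nat, [/\ 1 <= j <= n.+1, n %| j + k &
      w = spiral_C n 0 j * spiral_C n 1 n ^+ k]) \/
  (exists i k : nat, [/\ i <= n, n %| i + k + 1 &
      w = spiral_C n i 1 * spiral_C n n 1 ^+ k]).

(* Main.v *)
(** Left multiplication by the generators makes the affine symmetric group act on
    Z, and the cosets of W_S become (n+1)-cores in abacus form: functions L on Z
    with L (j + n + 1) = L j + 1 and balanced sum, position j carrying a bead when
    L j < 0.  Bruhat order on minimal representatives is containment of cores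
    (comparison of the numbers of beads to the right of every position), and the
    length is a sum over pairs of residue classes.

    There is one element of length 1 and there are at most two of length 2, so a
    palindromic w <> 1 covers one element only and has at most two elements two
    steps below it.  One lower cover forces a unique left descent, and then the
    window x_0 <= ... <= x_n of levels read after this descent is nondecreasing.
    If x_n - x_0 <= 2 the core is a rectangle and w is a cpo.  Otherwise an
    intermediate value in the window produces a second lower cover, and a window
    with two values, each taken at least twice, produces three elements two steps
    below w; the windows that remain are those of the spiral elements.

    Conversely, the cores inside a rectangle are reversed by a half turn, and the
    cores below the spiral element of length m n are the compositions of m into
    n + 1 parts.  Rotating the window shows that their generating function
    satisfies the recursion of the Gaussian binomial coefficient of n + m over m,
    which is symmetric. *)

Require Import Defs.
From mathcomp Require Import all_boot all_order all_algebra zify ring.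
From mathcomp Require Import finmap boolp classical_sets cardinality.

Set Implicit Arguments.
Unset Strict Implicit.
Unset Printing Implicit Defensive.

Import Order.TTheory GRing.Theory Num.Theory.
Local Open Scope ring_scope.

(** The group is known only through its presentation, so lengths have to be recovered from the
    action on Z. The step that costs work is [len_asc]: a generator that lengthens w leaves the
    corresponding neighbours in order. It makes the action faithful, and this ties lengths and
    Bruhat steps to inversions. Since [posw] reverses products, left factors permute the positions
    of a level function while right factors from W_S leave it unchanged; Bruhat steps, defined by
    right factors, are therefore conjugated to the left side.

    The bound 2 on x_n - x_0 comes from cutting the window at an ascent. After the cut all entries
    lie in two adjacent values, and such an element has a word without the generator at the cut. So
    a generator at an ascent is never below w, which is the cpo condition. In the opposite
    direction, the sides of the rectangle of a cpo are the distances from s_0 to the nearest absent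
    generators on either side.

    Symmetry of the Gaussian polynomial is not visible on compositions; it results from having both
    Pascal recursions, which reversal of the coefficients exchanges. *)

Lemma int_shift_const (T : Type) (F : int -> T) :
  (forall j : int, F (j + 1) = F j) -> forall j k : int, F j = F k.
Proof.
move=> FS j k.
have up m i : F (i + m%:Z) = F i.
  by elim: m => [|m IH]; rewrite ?addr0 // -[RHS]IH -[RHS]FS; congr F; lia.
have [le|le] : (j <= k) \/ (k <= j) by lia.
  by rewrite -(up `|k - j|%N j); congr F; lia.
by rewrite -[RHS](up `|j - k|%N k); congr F; lia.
Qed.

Lemma sum_cons (x : int) (s : seq int) : \sum_(y <- x :: s) y = x + \sum_(y <- s) y.
Proof. exact: big_cons. Qed.

Lemma sum_rcons (s : seq int) (x : int) :
  \sum_(y <- rcons s x) y = \sum_(y <- s) y + x.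
Proof. by rewrite -cats1 big_cat big_seq1. Qed.

Lemma sum_bounds (s : seq int) (a b : int) : {in s, forall x, a <= x <= b} ->
  (size s)%:Z * a <= \sum_(x <- s) x <= (size s)%:Z * b.
Proof.
elim: s => [|x s IH] h; first by rewrite big_nil !mul0r lexx.
have {}IH := IH (fun y hy => h y (@mem_behead _ (x :: s) y hy)).
by have := h x (mem_head x s); move: IH; rewrite sum_cons /=; nia.
Qed.

Lemma sum_eq0 (s : seq int) : {in s, forall x, 0 <= x} -> \sum_(x <- s) x = 0 ->
  {in s, forall x, x = 0}.
Proof.
elim: s => [|x s IH] h e y //; rewrite sum_cons in e; rewrite inE => hy.
have hs : {in s, forall x, 0 <= x} by move=> z hz; apply: h; rewrite inE hz orbT.
have : 0 <= \sum_(z <- s) z by rewrite big_seq; apply: sumr_ge0 => z /hs.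
have := h x (mem_head x s) => x0 s0.
have [x0' s0'] : x = 0 /\ \sum_(z <- s) z = 0 by lia.
by case/orP: hy => [/eqP -> //|]; apply: IH.
Qed.

Lemma first_index (P : nat -> bool) (m : nat) : P m ->
  exists c, [/\ (c <= m)%N, P c & forall i, (i < c)%N -> ~~ P i].
Proof.
move=> Pm; have ex : exists i, P i by exists m.
case: (ex_minnP ex) => c Pc h; exists c; split=> //; first exact: h.
by move=> i ic; apply/negP => /h; lia.
Qed.

(** * Cores on the line *)

Section AffineLine.
Variable n : nat.
Implicit Types (L M : int -> int) (a b c j k t x y : int).
Local Notation N := (n.+1%:Z).

Definition eqm (a b : int) : bool := (N %| a - b)%Z.

Lemma eqmP a b : reflect (exists t : int, a = b + t * N) (eqm a b).
Proof.
apply: (iffP dvdzP) => [[q e]|[t ->]]; [exists q | exists t]; first by lia.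
by rewrite addrAC subrr add0r.
Qed.

Lemma eqmxx a : eqm a a. Proof. by apply/eqmP; exists 0; lia. Qed.

Lemma eqm_sym a b : eqm a b = eqm b a.
Proof.
by apply/eqmP/eqmP => -[t ->]; exists (- t); lia.
Qed.

Lemma eqm_trans a b c : eqm a b -> eqm b c -> eqm a c.
Proof. by move=> /eqmP[t ->] /eqmP[s ->]; apply/eqmP; exists (s + t); lia. Qed.

Lemma eqmDr c a b : eqm (a + c) (b + c) = eqm a b.
Proof. by rewrite /eqm; congr dvdz; lia. Qed.

Lemma eqm_shift t a b : eqm (a + t * N) b = eqm a b.
Proof.
apply/eqmP/eqmP => [[s e]|[s ->]]; last by exists (s + t); lia.
by exists (s - t); lia.
Qed.

Lemma eqm_eq a b : eqm a b -> - N < a - b < N -> a = b.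
Proof.
move=> /eqmP[t ->] h; have t0 : t = 0 by nia.
by rewrite t0; lia.
Qed.

Lemma eqm_neq a b : a != b -> - N < a - b < N -> eqm a b = false.
Proof. by move=> ne h; apply/negP => /eqm_eq /(_ h) e; rewrite e eqxx in ne. Qed.

Lemma eqmS a : (0 < n)%N -> eqm a (a + 1) = false.
Proof. by move=> n0; apply: eqm_neq; lia. Qed.

(** For a and b in different classes this is the reflection exchanging [a + t * N] and [b + t * N]
    for all t. When [eqm a b] holds it translates that class by b - a, which is why the involution
    lemmas assume [eqm a b = false]. *)
Definition rfl (a b j : int) : int :=
  if eqm j a then j - a + b else if eqm j b then j - b + a else j.

Lemma rflL a b t : rfl a b (a + t * N) = b + t * N.
Proof. by rewrite /rfl eqm_shift eqmxx; lia. Qed.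

Lemma rflR a b t : eqm a b = false -> rfl a b (b + t * N) = a + t * N.
Proof. by move=> h; rewrite /rfl !eqm_shift eqmxx eqm_sym h; lia. Qed.

Lemma rflD a b j : eqm j a = false -> eqm j b = false -> rfl a b j = j.
Proof. by rewrite /rfl => -> ->. Qed.

Lemma rfl_aff a b j t : rfl a b (j + t * N) = rfl a b j + t * N.
Proof. by rewrite /rfl !eqm_shift; do 2?case: ifP => _; lia. Qed.

Lemma rfl_l a b : rfl a b a = b.
Proof. by rewrite /rfl eqmxx; lia. Qed.

Lemma rfl_r a b : eqm a b = false -> rfl a b b = a.
Proof. by move=> h; rewrite /rfl eqm_sym h eqmxx; lia. Qed.

Lemma rflK a b : eqm a b = false -> involutive (rfl a b).
Proof.
move=> h j; case ja: (eqm j a).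
  by move/eqmP: ja => [t ->]; rewrite rflL rflR.
case jb: (eqm j b); last by rewrite !rflD.
by move/eqmP: jb => [t ->]; rewrite rflR ?rflL.
Qed.

Lemma rfl_shift t a b : rfl (a + t * N) (b + t * N) = rfl a b.
Proof.
apply: funext => j; rewrite /rfl (eqm_sym j (a + _)) (eqm_sym j (b + _)).
by rewrite !eqm_shift !(eqm_sym _ j); do 2?case: ifP => _; lia.
Qed.

Lemma rfl_conj (F : int -> int) a b j :
    (forall j t, F (j + t * N) = F j + t * N) -> injective F ->
  F (rfl a b j) = rfl (F a) (F b) (F j).
Proof.
move=> Faff Finj.
have E c : eqm (F j) (F c) = eqm j c.
  apply/eqmP/eqmP => [[t]|[t ->]]; last by exists t; rewrite Faff.
  by rewrite -Faff => /Finj ->; exists t.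
rewrite /rfl !E; case: ifP => [/eqmP[t ->]|_].
  rewrite Faff; have -> : a + t * N - a + b = b + t * N by lia.
  by rewrite Faff; lia.
case: ifP => // /eqmP[t ->].
rewrite Faff; have -> : b + t * N - b + a = a + t * N by lia.
by rewrite Faff; lia.
Qed.

Definition tau (k : int) : int -> int := rfl k (k + 1).

Lemma tau_shift t k : tau (k + t * N) = tau k.
Proof. by rewrite /tau -[RHS](rfl_shift t); congr rfl; lia. Qed.

Lemma tau_bound k j : j - 1 <= tau k j <= j + 1.
Proof. by rewrite /tau /rfl; do 2?case: ifP => _; lia. Qed.

Lemma tauK k : (0 < n)%N -> involutive (tau k).
Proof. by move=> n0; apply: rflK; rewrite eqmS. Qed.

Lemma tau_inj k : (0 < n)%N -> injective (tau k).
Proof. by move=> n0; apply: can_inj (tauK k n0). Qed.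

(* A simple reflection can only invert a pair of neighbours that it swaps. *)
Lemma tau_inv k a b : (0 < n)%N -> a < b -> tau k b < tau k a -> rfl a b = tau k.
Proof.
move=> n0 ab h; have /andP[_ ha] := tau_bound k a.
have /andP[hb _] := tau_bound k b.
have eb : b = a + 1 by lia.
have ea : tau k a = a + 1 by lia.
suff /eqmP[t at'] : eqm a k by rewrite eb at' -(tau_shift t k) /tau.
move: ea; rewrite {1}/tau /rfl; case: ifP => // _; case: ifP => _; lia.
Qed.

Lemma window_ex a j : exists (i : 'I_n.+1) (s : int), a + s * N = j + i%:Z.
Proof.
have h0 : 0 <= ((a - j) %% N)%Z by rewrite modz_ge0.
have h1 : ((a - j) %% N)%Z < N by rewrite ltz_pmod.
have lt : (`|((a - j) %% N)%Z| < n.+1)%N by lia.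
exists (Ordinal lt), (- ((a - j) %/ N)%Z) => /=.
have := divz_eq (a - j) N; lia.
Qed.

Definition aff (L : int -> int) : Prop := forall j t, L (j + t * N) = L j + t.

Lemma aff_rfl L a b : aff L -> aff (L \o rfl a b).
Proof. by move=> h j t; rewrite /= rfl_aff h. Qed.

Definition win (L : int -> int) (j : int) : seq int :=
  [seq L (j + i%:Z) | i <- iota 0 n.+1].

(** The entries common to the windows at j - 1 and at j: moving the window of an affine L by one
    step turns [x :: s] into [rcons s (x + 1)]. *)
Definition wtl (L : int -> int) (j : int) : seq int :=
  [seq L (j + i%:Z) | i <- iota 0 n].

Lemma size_win L j : size (win L j) = n.+1.
Proof. by rewrite size_map size_iota. Qed.

Lemma win_cons L j : win L j = L j :: wtl L (j + 1).
Proof.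
rewrite /win /wtl /= addr0; congr cons.
rewrite -(addn0 1%N) iotaDl -map_comp; apply: eq_map => i /=; congr L; lia.
Qed.

Lemma win_rcons L j : aff L -> win L (j + 1) = rcons (wtl L (j + 1)) (L j + 1).
Proof.
move=> aL; rewrite /win /wtl -(addn1 n) iotaD map_cat cats1; congr rcons.
by rewrite -[in RHS](mul1r (1 : int)) -aL; congr L; lia.
Qed.

Lemma nth_win L j i : (i <= n)%N -> nth 0 (win L j) i = L (j + i%:Z).
Proof. by move=> h; rewrite (nth_map 0%N) ?size_iota // nth_iota. Qed.

Lemma mem_win L j x :
  reflect (exists2 i, (i <= n)%N & x = L (j + i%:Z)) (x \in win L j).
Proof.
apply: (iffP mapP) => [[i]|[i h ->]].
  by rewrite mem_iota => h ->; exists i; lia.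
by exists i => //; rewrite mem_iota.
Qed.

(* For levels x and y at positions i < j < i + N, this is the floor of |p - q| / N,
   where p and q are the positions of level 0 in the classes of i and j. *)
Definition phi (x y : int) : nat := if x < y then absz (y - x - 1)%R else absz (x - y)%R.

Fixpoint ells (s : seq int) : nat :=
  if s is x :: s' then (\sum_(y <- s') phi x y + ells s')%N else 0%N.

Lemma ells_cat (s t : seq int) :
  ells (s ++ t) = (ells s + ells t + \sum_(x <- s) \sum_(y <- t) phi x y)%N.
Proof.
elim: s => [|x s IH] /=; first by rewrite big_nil addn0.
by rewrite IH big_cat big_cons /=; lia.
Qed.

Lemma ells_rcons s y : ells (rcons s y) = (ells s + \sum_(x <- s) phi x y)%N.
Proof.
rewrite -cats1 ells_cat /= big_nil !addn0; congr addn.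
by apply: eq_bigr => x _; rewrite big_seq1.
Qed.

Lemma phi_rot x y : phi x y = phi y (x + 1).
Proof. rewrite /phi; do 2!case: ifP; lia. Qed.

(** By [phi_rot] a pair contributes the same after its first entry has been carried round the
    period. Hence [ells] does not depend on where the window starts. *)
Lemma ells_rot x s : ells (x :: s) = ells (rcons s (x + 1)).
Proof.
by rewrite ells_rcons /= addnC; congr addn; apply: eq_bigr => y _; exact: phi_rot.
Qed.

Definition ell (L : int -> int) : nat := ells (win L 1).

Lemma ell_win L j : aff L -> ells (win L j) = ell L.
Proof.
move=> aL; apply: (int_shift_const (F := fun j => ells (win L j))) => {}j.
by rewrite win_rcons // win_cons -ells_rot.
Qed.

(** A class whose first position in the window has level x < 0 carries beads at the levels x, ...,
    -1. *)
Definition negp (x : int) : nat := if x < 0 then absz x else 0%N.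

(* The number of beads (positions of negative level) at or to the right of j. *)
Definition beads (L : int -> int) (j : int) : nat := (\sum_(x <- win L j) negp x)%N.

Lemma beadsE L j : beads L j = (\sum_(i < n.+1) negp (L (j + i%:Z)%R))%N.
Proof. by rewrite /beads big_map -(big_mkord predT (fun i => negp (L (j + i%:Z)))) /index_iota subn0. Qed.

Lemma beadsS L j : aff L -> beads L j = (beads L (j + 1)%R + (L j < 0)%R)%N.
Proof.
move=> aL; rewrite /beads win_rcons // win_cons big_cons -cats1 big_cat big_seq1 /=.
by rewrite addnC -addnA; congr addn; rewrite /negp; do 2!case: ifP; lia.
Qed.

Definition core (L : int -> int) : Prop :=
  aff L /\ (\sum_(x <- win L 1) x = 0).

Lemma aff_sum_win L j k : aff L ->
  \sum_(x <- win L j) x - j = \sum_(x <- win L k) x - k.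
Proof.
move=> aL; apply: (int_shift_const (F := fun j : int => \sum_(x <- win L j) x - j)) => i.
by rewrite win_rcons // win_cons sum_cons sum_rcons; lia.
Qed.

Lemma sum_win L j : core L -> \sum_(x <- win L j) x = j - 1.
Proof. by move=> [aL s0]; have := aff_sum_win j 1 aL; rewrite s0; lia. Qed.

(* Charge zero: beads right of j and gaps left of j determine each other. *)
Lemma beads_gaps L j : core L ->
  (beads L j)%:Z = 1 - j + (\sum_(x <- win L j) negp (- x)%R)%N%:Z.
Proof.
move=> cL; have := sum_win j cL.
suff -> : \sum_(x <- win L j) x =
   (\sum_(x <- win L j) negp (- x)%R)%N%:Z - (beads L j)%:Z by lia.
rewrite /beads; elim: (win L j) => [|x s IH]; first by rewrite !big_nil.
rewrite !big_cons IH !PoszD.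
by have : x = (negp (- x))%:Z - (negp x)%:Z; [rewrite /negp; do 2!case: ifP|]; lia.
Qed.

Definition fle (L M : int -> int) : Prop := forall j, (beads L j <= beads M j)%N.

Lemma fle_refl L : fle L L. Proof. by move=> j. Qed.

Lemma fle_trans L M P : fle L M -> fle M P -> fle L P.
Proof. by move=> h1 h2 j; apply: leq_trans (h1 j) (h2 j). Qed.

(** In the window at j the classes of a and b have levels [L a + s] and [L b + t] with t <= s. The
    exchange replaces them by [L b + s] and [L a + t], with the same sum and at least as far apart,
    and [negp] is convex. *)
Lemma fle_rfl L a b : aff L -> a < b -> eqm a b = false -> L a <= L b ->
  fle L (L \o rfl a b).
Proof.
move=> aL ab nab Lab j.
have [ia [s ea]] := window_ex a j; have [ib [t eb]] := window_ex b j.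
have nib : ib != ia.
  apply/negP => /eqP e; move: nab; rewrite -(eqm_shift s) ea -e -eb.
  by rewrite eqm_shift eqmxx.
have ts : t <= s by have := ltn_ord ia; have := ltn_ord ib; nia.
rewrite !beadsE (bigD1 ia) //= (bigD1 ib) //= [leqRHS](bigD1 ia) //=.
rewrite [X in (_ <= _ + X)%N](bigD1 ib) //= -ea -eb rflL rflR // !aL !addnA.
apply: leq_add; first by rewrite /negp; do 4!case: ifP; lia.
rewrite leq_eqVlt; apply/orP; left; apply/eqP.
apply: eq_bigr => i /andP[nia nib'].
congr (negp (L _)); rewrite rflD //; apply/negP => /eqmP[r e].
  case/eqP: nia; apply: val_inj => /=.
  have /eqm_eq: eqm (j + i%:Z) (j + ia%:Z) by rewrite -ea e; apply/eqmP; exists (r - s); lia.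
  by have := ltn_ord ia; have := ltn_ord i; lia.
case/eqP: nib'; apply: val_inj => /=.
have /eqm_eq: eqm (j + i%:Z) (j + ib%:Z) by rewrite -eb e; apply/eqmP; exists (r - t); lia.
by have := ltn_ord ib; have := ltn_ord i; lia.
Qed.

Lemma core_perm L M j : aff L -> aff M -> perm_eq (win L j) (win M j) ->
  core L -> core M.
Proof.
move=> aL aM pLM cL; split=> //; have := aff_sum_win 1 j aM.
by rewrite -(perm_big _ pLM) /= (sum_win j cL); lia.
Qed.

End AffineLine.

(** * Swaps of neighbouring levels: length, beads and containment *)

Section Swap.
Variable n : nat.
Implicit Types (L M : int -> int) (a b c j k m t x y : int).
Hypothesis n_gt0 : (0 < n)%N.
Local Notation N := (n.+1%:Z).
Local Notation tau := (tau n).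
Local Notation aff := (aff n).
Local Notation core := (core n).
Local Notation fle := (fle n).
Local Notation beads := (beads n).

Lemma win2 L k : exists s, win n L k = [:: L k, L (k + 1) & s] /\
  win n (L \o tau k) k = [:: L (k + 1), L k & s].
Proof.
exists [seq L (k + i%:Z) | i <- iota 2 n.-1].
have e : iota 0 n.+1 = [:: 0%N, 1%N & iota 2 n.-1] by case: n n_gt0.
rewrite /win e /= !addr0 /tau rfl_l rfl_r ?eqmS //; split=> //.
do 2!congr cons; apply/eq_in_map => i; rewrite mem_iota => h /=.
by congr L; apply: rflD; apply: eqm_neq; lia.
Qed.

Lemma core_tau L k : core L -> core (L \o tau k).
Proof.
move=> cL; have [s [e1 e2]] := win2 L k; have aL := cL.1.
apply: (core_perm (j := k) aL) => //; first exact: aff_rfl.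
by rewrite e1 e2 -(perm_catCA [:: _] [:: _]).
Qed.

Lemma ell_tau L k : aff L ->
  ((ell n (L \o tau k))%:Z = (ell n L)%:Z + (L k < L (k + 1))%R%:R - (L (k + 1) < L k)%R%:R)%R.
Proof.
move=> aL; have [s [e1 e2]] := win2 L k.
rewrite -(ell_win k aL) -(ell_win k (aff_rfl _ _ aL)) e1 e2 /= !big_cons.
by rewrite /phi; do 2!case: ifP; lia.
Qed.

Lemma beads_tau L k : aff L -> beads (L \o tau k) (k + 1) = (beads L (k + 2)%R + (L k < 0)%R)%N.
Proof.
move=> aL; have [s [e1 e2]] := win2 L k; have aL' := aff_rfl k (k + 1) aL.
have e : beads (L \o tau k) k = beads L k by rewrite /beads e1 e2 !big_cons; lia.
have := beadsS k aL'; have := beadsS k aL; have := beadsS (k + 1) aL.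
have -> : k + 1 + 1 = k + 2 by lia.
by rewrite e /= /tau rfl_l; lia.
Qed.

(** If j is not congruent to k + 1, its window contains the swapped pair as two neighbours. The
    counts agree where the window starts with the pair, and this is carried back to j over positions
    fixed by [tau]. *)
Lemma beads_tauD L k j : aff L -> eqm n j (k + 1) = false -> beads (L \o tau k) j = beads L j.
Proof.
move=> aL nj; have aL' := aff_rfl k (k + 1) aL.
have [i [s e]] := window_ex n k j.
rewrite -(tau_shift n s k) e.
have [s' [e1 e2]] := win2 L (j + i%:Z).
have e3 : beads (L \o tau (j + i%:Z)) (j + i%:Z) = beads L (j + i%:Z).
  by rewrite /beads e1 e2 !big_cons; lia.
have ni : (i%:Z < n%:Z).
  case: (leqP n i) => // h; move: nj; rewrite -(eqm_shift n 1).
  have -> : j + 1 * N = k + s * N + 1 by have := ltn_ord i; lia.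
  have -> : k + s * N + 1 = k + 1 + s * N by lia.
  by rewrite eqm_shift eqmxx.
have {}aL' := aff_rfl (j + i%:Z) (j + i%:Z + 1) aL.
have H d : (d <= i)%N -> beads (L \o tau (j + i%:Z)) (j + i%:Z - d%:Z) = beads L (j + i%:Z - d%:Z).
  elim: d => [|d IH] h; first by rewrite subr0.
  have -> : j + i%:Z - d.+1%:Z = j + i%:Z - d%:Z - 1 by lia.
  rewrite (beadsS _ aL) (beadsS _ aL').
  have -> : j + i%:Z - d%:Z - 1 + 1 = j + i%:Z - d%:Z by lia.
  rewrite IH; last by lia.
  by congr addn; rewrite /= /tau rflD //; apply: eqm_neq; lia.
by have := H i (leqnn i); have -> : j + i%:Z - i%:Z = j by lia.
Qed.

Lemma fle_tau_case L M k : aff L -> aff M ->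
    (forall j, eqm n j (k + 1) = false -> (beads L j <= beads M j)%N) ->
    (forall t, (beads L (k + t * N + 1)%R <= beads M (k + t * N + 1)%R)%N) ->
  fle L M.
Proof.
move=> aL aM h1 h2 j; case e: (eqm n j (k + 1)); last exact: h1.
move/eqmP: e => [t ->]; have -> : k + 1 + t * N = k + t * N + 1 by lia.
exact: h2.
Qed.

(** Lifting for cores. Only counts at positions congruent to k + 1 change. The weak descent of M
    makes its count at k + 1 the largest compatible with its counts at k and k + 2, and these bound
    the count of [L \o tau k] too. *)
Lemma fle_tauL L M k : aff L -> aff M -> fle L M -> M (k + 1) <= M k ->
  fle (L \o tau k) M.
Proof.
move=> aL aM LM dM; apply: (fle_tau_case (k := k) (aff_rfl _ _ aL) aM) => [j h|t]; rewrite -/(tau k).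
  by rewrite beads_tauD.
have {}dM : M (k + t * N + 1) <= M (k + t * N).
  by have -> : k + t * N + 1 = k + 1 + t * N; [lia | rewrite !aM; lia].
rewrite -(tau_shift n t k) beads_tau //; move: (k + t * N) dM => {}k dM.
have := LM (k + 2); have := LM k.
have := beadsS k aL; have := beadsS k aM; have := beadsS (k + 1) aL; have := beadsS (k + 1) aM.
have -> : k + 1 + 1 = k + 2 by lia.
by move: dM; do 4![case: ltP]; lia.
Qed.

(** Dual to [fle_tauL]: a weak ascent makes the count of L at k + 1 the smallest compatible with its
    counts at k and k + 2. *)
Lemma fle_tauR L M k : aff L -> aff M -> fle L M -> L k <= L (k + 1) ->
  fle L (M \o tau k).
Proof.
move=> aL aM LM dL; apply: (fle_tau_case (k := k) aL (aff_rfl _ _ aM)) => [j h|t]; rewrite -/(tau k).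
  by rewrite beads_tauD.
have {}dL : L (k + t * N) <= L (k + t * N + 1).
  by have -> : k + t * N + 1 = k + 1 + t * N; [lia | rewrite !aL; lia].
rewrite -(tau_shift n t k) beads_tau //; move: (k + t * N) dL => {}k dL.
have := LM (k + 2); have := LM k.
have := beadsS k aL; have := beadsS k aM; have := beadsS (k + 1) aL; have := beadsS (k + 1) aM.
have -> : k + 1 + 1 = k + 2 by lia.
by move: dL; do 4![case: ltP]; lia.
Qed.

(** The empty core, with beads exactly at the positions j <= 0. *)
Definition base (j : int) : int := ((j - 1) %/ N)%Z.

Lemma aff_floor m : aff (fun j => ((j - m) %/ N)%Z).
Proof. 
move=> j t; have -> : j + t * N - m = t * N + (j - m) by lia.
by rewrite divzMDl // addrC.
 Qed.

Lemma aff_base : aff base. Proof. exact: aff_floor. Qed.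

Lemma floor_small (x : int) : 0 <= x < N -> (x %/ N)%Z = 0.
Proof. by move=> h; rewrite divz_small. Qed.

Lemma win_base : win n base 1 = nseq n.+1 0.
Proof.
apply: (@eq_from_nth _ 0) => [|i]; rewrite size_win ?size_nseq // => h.
by rewrite nth_win // nth_nseq h /base floor_small //; lia.
Qed.

Lemma core_base : core base.
Proof.
by split; [exact: aff_base | rewrite win_base big1_seq // => x /andP[_ /nseqP[]]].
Qed.

Lemma ells_nseq (m : nat) x : ells (nseq m x) = 0%N.
Proof.
elim: m => //= m ->; rewrite addn0 big1_seq // => y /andP[_ /nseqP[-> _]].
by rewrite /phi ltxx subrr.
Qed.

Lemma ell_base : ell n base = 0%N.
Proof. by rewrite /ell win_base ells_nseq. Qed.

Lemma aff_eq_win L M j : aff L -> aff M ->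
  (forall i, (i <= n)%N -> L (j + i%:Z) = M (j + i%:Z)) -> L = M.
Proof.
move=> aL aM h; apply: funext => a; have [i [s e]] := window_ex n a j.
by have := h i (ltn_ord i); rewrite -e aL aM => /addIr.
Qed.

(** A nondecreasing L gains only 1 over a period, so a window takes no values but [L 1] and
    [L 1 + 1]. Sum zero, with [L 1] itself among the entries, then leaves only zeros. *)
Lemma core_sorted L : core L -> (forall k, L k <= L (k + 1)) -> L = base.
Proof.
move=> cL mono; have aL := cL.1.
have up (m : nat) j : L j <= L (j + m%:Z).
  elim: m => [|m IH]; first by rewrite addr0.
  by apply: le_trans IH _; have -> : j + m.+1%:Z = j + m%:Z + 1; [lia | exact: mono].
have bd i : (i <= n)%N -> L 1 <= L (1 + i%:Z) <= L 1 + 1.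
  move=> h; rewrite up /= -(mul1r 1) -aL.
  have -> : 1 + 1 * N = 1 + i%:Z + (n.+1 - i)%N%:Z by lia.
  exact: up.
have S1 : {in wtl n L (1 + 1), forall x, L 1 <= x <= L 1 + 1}.
  move=> x /mapP[i]; rewrite mem_iota => hi ->.
  have -> : 1 + 1 + i%:Z = 1 + i.+1%:Z by lia.
  by apply: bd; lia.
have S := cL.2; rewrite win_cons sum_cons in S.
have := sum_bounds S1; rewrite size_map size_iota => S2.
have L1 : L 1 = 0.
  move: S S2; set S := \sum_(y <- _) y; move: (L 1) S => x S e /andP[l1 l2].
  have [//|[h|h]] : x = 0 \/ (1 <= x \/ x <= - 1) by lia.
    by have : n%:Z * 1 <= n%:Z * x; [apply: ler_wpM2l | lia].
  by have : n%:Z * (x + 1) <= n%:Z * 0; [apply: ler_wpM2l; lia | lia].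
have W0 : {in win n L 1, forall x, x = 0}.
  apply: sum_eq0 cL.2 => x; rewrite win_cons inE => /orP[/eqP ->|/S1]; lia.
apply: (aff_eq_win (j := 1) aL aff_base) => i hi.
rewrite /base floor_small; last by lia.
by apply: W0; apply/mem_win; exists i.
Qed.

Lemma core_desc L : core L -> L <> base -> exists k, L (k + 1) < L k.
Proof.
move=> cL; apply: contra_notP => h; apply: core_sorted => // k.
by rewrite leNgt; apply/negP => hk; apply: h; exists k.
Qed.

End Swap.

(** * Affine permutations *)

Section Positions.
Variable n : nat.
Hypothesis n_gt0 : (0 < n)%N.
Local Notation N := (n.+1%:Z).
Local Notation tau := (tau n).
Implicit Types (u v : seq 'I_n.+1) (w x y z : affA n) (a b j k q t : int).

(** Conjugating one swap by the other yields, on both sides, the reflection exchanging the classes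
    of k and k + 2. *)
Lemma tau_braid k j : (1 < n)%N ->
  tau k (tau (k + 1) (tau k j)) = tau (k + 1) (tau k (tau (k + 1) j)).
Proof.
move=> n1; have E (a b c i : int) : tau a (rfl n b c (tau a i)) = rfl n (tau a b) (tau a c) i.
  by rewrite (@rfl_conj n (tau a)) ?tauK //; [exact: rfl_aff | exact: tau_inj].
rewrite {2}/tau {4}/tau !E //; congr rfl; rewrite /tau ?rfl_l ?rfl_r ?eqmS //.
  by rewrite rflD //; apply: eqm_neq; lia.
by rewrite rflD //; apply: eqm_neq; lia.
Qed.

Lemma tauC a b j : eqm n b a = false -> eqm n b (a + 1) = false ->
  eqm n a (b + 1) = false -> tau a (tau b j) = tau b (tau a j).
Proof.
move=> h1 h2 h3; rewrite {2}/tau (@rfl_conj n (tau a)).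
- congr rfl; apply: rflD => //; first by rewrite eqm_sym.
  by rewrite -(eqmDr n 1) in h1.
- exact: rfl_aff.
- exact: tau_inj.
Qed.

(* The inverse of the affine permutation of Z represented by u. *)
Fixpoint pos u j : int := if u is a :: u' then pos u' (tau (a : nat)%:Z j) else j.

Lemma pos_cat u v j : pos (u ++ v) j = pos v (pos u j).
Proof. by elim: u j => //= a u IH j. Qed.

Lemma pos_aff u j t : pos u (j + t * N) = pos u j + t * N.
Proof. by elim: u j => //= a u IH j; rewrite /tau rfl_aff IH. Qed.

Lemma pos_inj u : injective (pos u).
Proof. by elim: u => //= a u IH j k /IH; apply: tau_inj. Qed.

Lemma eqm_nat (a b : nat) : eqm n a b = (a == b %[mod n.+1]).
Proof. by rewrite /eqm -eqz_mod_dvd !modz_nat eqz_nat. Qed.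

Lemma pos_rel (a b : 'I_n.+1) j : pos (flatten (nseq (affA_mx a b) [:: a; b])) j = j.
Proof.
rewrite /affA_mx; case: eqP => [->|ab] /=; first by rewrite tauK.
have ab' : eqm n (b : nat) (a : nat) = false.
  apply/negP; rewrite eqm_nat !modn_small // => /eqP e; case: ab.
  exact: val_inj.
case: eqP => [//|n1]; have {}n1 : (1 < n)%N by lia.
have K := tauK _ n_gt0.
rewrite -!eqm_nat; case: ifP => [/orP[] h|/norP[h1 h2]] /=.
- have /eqmP[t] : eqm n (b : nat) ((a : nat)%:Z + 1) by rewrite eqm_sym -PoszD addn1.
  by move=> ->; rewrite tau_shift tau_braid // !K.
- have /eqmP[t] : eqm n (a : nat) ((b : nat)%:Z + 1) by rewrite eqm_sym -PoszD addn1.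
  by move=> ->; rewrite tau_shift -tau_braid // !K.
have C i : tau a (tau b i) = tau b (tau a i).
  apply: tauC => //; apply/negbTE; rewrite eqm_sym -PoszD addn1 //.
by rewrite C !K.
Qed.

Lemma pos_eqv u v : affA_eqv u v -> pos u = pos v.
Proof.
elim=> // [{}u {}v a b|x y z _ -> _ ->] //.
by apply: funext => j; rewrite !pos_cat pos_rel.
Qed.

Definition posw w : int -> int := pos (repr w).

Lemma posw_word u : posw (affA_word u) = pos u.
Proof. by apply: pos_eqv; apply: affA_repr_word. Qed.

Lemma posw_mul x y j : posw (x * y)%g j = posw y (posw x j).
Proof.
by rewrite -(affA_word_repr x) -(affA_word_repr y) [(_ * _)%g]affA_mulE !posw_word pos_cat.
Qed.

Lemma posw1 j : posw 1%g j = j.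
Proof. by rewrite [1%g]/(affA_one n) posw_word. Qed.

Lemma posw_aff w j t : posw w (j + t * N) = posw w j + t * N.
Proof. exact: pos_aff. Qed.

Lemma posw_inj w : injective (posw w).
Proof. exact: pos_inj. Qed.

Lemma posw_invK w j : posw w (posw w^-1%g j) = j.
Proof. by rewrite -posw_mul mulVg posw1. Qed.

Lemma posw_Kinv w j : posw w^-1%g (posw w j) = j.
Proof. by rewrite -posw_mul mulgV posw1. Qed.

Definition sg k : affA n := affA_gen n (absz (k %% N)%Z).

Lemma sg_nat (k : nat) : affA_gen n k = sg k.
Proof.
rewrite /sg /affA_gen modz_nat; congr (affA_word [:: _]); apply: val_inj => /=.
by rewrite modn_mod.
Qed.

Lemma sg_ord (a : 'I_n.+1) : affA_word [:: a] = sg (a : nat).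
Proof. by rewrite -sg_nat /affA_gen valZpK. Qed.

Lemma sg_shift k t : sg (k + t * N) = sg k.
Proof. by rewrite /sg addrC modzMDl. Qed.

Lemma sg_eqm a b : eqm n a b -> sg a = sg b.
Proof. by move=> /eqmP[t ->]; rewrite sg_shift. Qed.

Lemma sg_ex k : exists a : 'I_n.+1, sg k = affA_word [:: a] /\ eqm n k (a : nat).
Proof.
exists (inZp (absz (k %% N)%Z)); split=> //=; apply/eqmP; exists (k %/ N)%Z.
have h0 : 0 <= (k %% N)%Z by rewrite modz_ge0.
have h1 : (k %% N)%Z < N by rewrite ltz_pmod.
by rewrite modn_small; [have := divz_eq k N; lia | lia].
Qed.

Lemma posw_sg k : posw (sg k) = tau k.
Proof.
have [a [-> /eqmP[t ->]]] := sg_ex k.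
by apply: funext => j; rewrite posw_word tau_shift.
Qed.

Lemma posw_sgmul k w j : posw (sg k * w)%g j = posw w (tau k j).
Proof. by rewrite posw_mul posw_sg. Qed.

Lemma word_cons (a : 'I_n.+1) u : affA_word (a :: u) = (sg (a : nat) * affA_word u)%g.
Proof. by rewrite -sg_ord [RHS]affA_mulE. Qed.

Lemma word_rel (a b : 'I_n.+1) : affA_word (flatten (nseq (affA_mx a b) [:: a; b])) = 1%g.
Proof.
apply/affA_wordP; have := affA_eqv_rel [::] [::] a b.
by rewrite cat0s cats0.
Qed.

Lemma sg2 k : (sg k * sg k)%g = 1%g.
Proof.
have [a [-> _]] := sg_ex k; rewrite [LHS]affA_mulE /=.
by have := word_rel a a; rewrite /affA_mx eqxx.
Qed.

Lemma sgK k w : (sg k * (sg k * w))%g = w.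
Proof. by rewrite mulgA sg2 mul1g. Qed.

Lemma sgV k : ((sg k)^-1)%g = sg k.
Proof. by rewrite -[RHS]mulg1 -(mulgV (sg k)) mulgA sg2 mul1g. Qed.

Lemma sgC a b : (1 < n)%N -> eqm n b a = false -> eqm n b (a + 1) = false ->
  eqm n a (b + 1) = false -> (sg a * sg b = sg b * sg a)%g.
Proof.
move=> n1; have [a' [-> ea]] := sg_ex a; have [b' [-> eb]] := sg_ex b => h1 h2 h3.
have := word_rel a' b'; rewrite /affA_mx.
case: eqP => [e|_].
  by rewrite (eqm_trans eb) // in h1; rewrite eqm_sym e in ea.
case: eqP => [e|_]; first by rewrite e in n1.
rewrite -!eqm_nat; case: ifP => [/orP[] h|_ /=].
- move: h2; rewrite (eqm_trans eb) // eqm_sym; apply: eqm_trans h.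
  by rewrite -addn1 PoszD eqmDr.
- move: h3; rewrite (eqm_trans ea) // eqm_sym; apply: eqm_trans h.
  by rewrite -addn1 PoszD eqmDr.
move=> e; rewrite !word_cons in e.
have := congr1 (fun z => sg (b' : nat) * (sg (a' : nat) * z))%g e.
by rewrite !sgK !mulg1 !sg_ord.
Qed.

Lemma sg_braid k : (1 < n)%N ->
  (sg k * (sg (k + 1) * sg k) = sg (k + 1) * (sg k * sg (k + 1)))%g.
Proof.
move=> n1; have [a [ea1 ea]] := sg_ex k; have [b [eb1 eb]] := sg_ex (k + 1).
have hab : eqm n (a : nat).+1 (b : nat).
  rewrite -addn1 PoszD; apply: eqm_trans eb; rewrite eqmDr eqm_sym //.
have := word_rel a b; rewrite /affA_mx; case: eqP => [e|_].
  by move: hab; rewrite e -addn1 PoszD eqm_sym eqmS.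
case: eqP => [e|_]; first by rewrite e in n1.
rewrite -!eqm_nat hab /= !word_cons -!sg_ord -ea1 -eb1 => e.
have := congr1 (fun z => sg k * (sg (k + 1) * (sg k * z)))%g e.
by rewrite !sgK !mulg1 => ->.
Qed.

Local Notation len := (@affA_length n).

Lemma len_word u : (len (affA_word u) <= size u)%N.
Proof.
rewrite /affA_length; case: ex_minnP => m _; apply.
by apply/asboolP; exists u.
Qed.

Lemma len_ex w : exists u, affA_word u = w /\ size u = len w.
Proof. by rewrite /affA_length; case: ex_minnP => m /asboolP. Qed.

Lemma len1 : len 1%g = 0%N.
Proof. by apply/eqP; rewrite -leqn0 (len_word [::]). Qed.

Lemma len_eq0 w : len w = 0%N -> w = 1%g.
Proof. by have [[|a u] [<- <-]] := len_ex w. Qed.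

Lemma len_sg_le k w : (len (sg k * w)%g <= (len w).+1)%N.
Proof.
have [u [<- <-]] := len_ex w; have [a [-> _]] := sg_ex k.
by rewrite [X in affA_length X]affA_mulE; apply: len_word.
Qed.

Lemma size_eqv u v : affA_eqv u v -> odd (size u) = odd (size v).
Proof.
elim=> // [{}u {}v a b|x y z _ -> _ ->] //.
have e : odd (size (flatten (nseq (affA_mx a b) [:: a; b]))) = false.
  by elim: (affA_mx a b) => //= m ->.
by rewrite !size_cat !oddD e.
Qed.

Lemma len_odd u : odd (len (affA_word u)) = odd (size u).
Proof. by have [v [e <-]] := len_ex (affA_word u); apply: size_eqv; apply/affA_wordP. Qed.

Lemma odd_mul x y : odd (len (x * y)%g) = odd (len x) (+) odd (len y).
Proof.
have [u [<- _]] := len_ex x; have [v [<- _]] := len_ex y.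
by rewrite [X in affA_length X]affA_mulE !len_odd size_cat oddD.
Qed.

Lemma odd_sg k : odd (len (sg k)).
Proof. by have [a [-> _]] := sg_ex k; rewrite len_odd. Qed.

Lemma len_sg_cases k w : (len (sg k * w)%g = (len w).+1 \/ (len (sg k * w)%g).+1 = len w)%N.
Proof.
have h1 := len_sg_le k w; have := len_sg_le k (sg k * w)%g; rewrite sgK => h2.
have : len (sg k * w)%g <> len w.
  by move=> e; have := odd_mul (sg k) w; rewrite e odd_sg /=; case: odd.
lia.
Qed.

Lemma len_desc w : w <> 1%g -> exists k, (len (sg k * w)%g < len w)%N.
Proof.
move=> w1; have [[|a u] [e s]] := len_ex w; first by case: w1.
exists (a : nat); rewrite -s -e word_cons sgK ltnS; exact: len_word.
Qed.

(* Positivity of roots, by induction on the length inside the dihedral subgroup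
   generated by s_k and a left descent s_q of w. *)
Lemma len_asc w k : (len w < len (sg k * w)%g)%N -> posw w k < posw w (k + 1).
Proof.
have [m] := ubnP (len w); elim: m w k => // m IH w k lem lt.
have [->|/len_desc[q dq]] := EM (w = 1%g); first by rewrite !posw1; lia.
have ew : w = (sg q * (sg q * w))%g by rewrite sgK.
set v := (sg q * w)%g in dq ew; have lv : (len v).+1 = len w by have := len_sg_cases q w; rewrite -/v; lia.
have up_v : posw v q < posw v (q + 1) by apply: IH; [lia | rewrite -ew; lia].
have nqk : eqm n q k = false.
  by apply/negP => /sg_eqm e; rewrite -e -/v in lt; lia.
clearbody v; have [n1|n2] : n = 1%N \/ (1 < n)%N by lia.
  (* With two generators only, q is congruent to k + 1, and the inequality for v, read modulo the
     period, gives the claim with room to spare. *)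
  have /eqmP[t eq] : eqm n q (k + 1).
    have [i [s e]] := window_ex n q k; have := ltn_ord i => li.
    have [i0|i1] : (i = 0%N :> nat) \/ (i = 1%N :> nat) by lia.
      by move: nqk; rewrite -(eqm_shift n s) e i0 addr0 eqmxx.
    by apply/eqmP; exists (- s); lia.
  move: up_v; rewrite eq; have -> : k + 1 + t * N + 1 = k + (t + 1) * N by lia.
  rewrite !posw_aff ew !posw_sgmul eq tau_shift /tau rfl_l.
  have -> : k + 1 + 1 = k + 1 * N by lia.
  have -> : rfl n (k + 1) (k + 1 * N) k = k + 1 + (- 1) * N.
    have {3}-> : k = (k + 1 * N) + (- 1) * N by lia.
    by rewrite rflR //; apply: eqm_neq; lia.
  by rewrite !posw_aff; lia.
case e1: (eqm n q (k + 1)).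
- have es := sg_eqm e1; move/eqmP: e1 => [t et].
  have {}up_v : posw v (k + 1) < posw v (k + 2).
    move: up_v; have -> : q + 1 = k + 2 + t * N by lia.
    by rewrite et !posw_aff; lia.
  have ev : w = (sg (k + 1) * v)%g by rewrite -es.
  have [l1|l1] := len_sg_cases k v.
    have h : posw v k < posw v (k + 1) by apply: IH; lia.
    rewrite ev !posw_sgmul /tau rfl_l rflD; try by apply: eqm_neq; lia.
    by have -> : k + 1 + 1 = k + 2; lia.
  have ez : v = (sg k * (sg k * v))%g by rewrite sgK.
  move: (sg k * v)%g l1 ez => z l1 ez.
  (* If [sg (k + 1)] shortened z, the braid relation would bound the length of [sg k * w] by that of
     v, although [sg k] lengthens w. *)
  have h : posw z (k + 1) < posw z (k + 1 + 1).
    apply: IH; first by lia.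
    have [->//|l2] := len_sg_cases (k + 1) z.
    have e : (sg k * w = sg (k + 1) * (sg k * (sg (k + 1) * z)))%g.
      by rewrite ev ez; have := congr1 (fun y => y * z)%g (sg_braid k n2); rewrite -!mulgA.
    have := len_sg_le (k + 1) (sg k * (sg (k + 1) * z))%g.
    have := len_sg_le k (sg (k + 1) * z)%g; rewrite -e; lia.
  rewrite ev ez !posw_sgmul.
  have -> : tau (k + 1) k = k by apply: rflD; apply: eqm_neq; lia.
  have -> : tau (k + 1) (k + 1) = k + 1 + 1 by rewrite /tau rfl_l.
  have -> : tau k k = k + 1 by rewrite /tau rfl_l.
  by have -> : tau k (k + 1 + 1) = k + 1 + 1 by apply: rflD; apply: eqm_neq; lia.
case e2: (eqm n k (q + 1)).
- have es := sg_eqm e2; have [t et] := eqmP _ _ _ e2.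
  have {}up_v : posw v (k - 1) < posw v k.
    move: up_v; have -> : q + 1 = k + (- t) * N by lia.
    have -> : q = k - 1 + (- t) * N by lia.
    by rewrite !posw_aff; lia.
  have esq : sg q = sg (k - 1) by rewrite -(sg_shift (k - 1) (- t)); congr sg; lia.
  have ev : w = (sg (k - 1) * v)%g by rewrite -esq.
  have [l1|l1] := len_sg_cases k v.
    have h : posw v k < posw v (k + 1) by apply: IH; lia.
    rewrite ev !posw_sgmul.
    have -> : tau (k - 1) k = k - 1.
      rewrite /tau; have -> : k - 1 + 1 = k by lia.
      by rewrite rfl_r //; apply: eqm_neq; lia.
    by have -> : tau (k - 1) (k + 1) = k + 1; [apply: rflD; apply: eqm_neq; lia | lia].
  have ez : v = (sg k * (sg k * v))%g by rewrite sgK.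
  move: (sg k * v)%g l1 ez => z l1 ez.
  have k1 : k - 1 + 1 = k by lia.
  have h : posw z (k - 1) < posw z (k - 1 + 1).
    apply: IH; first by lia.
    have [->//|l2] := len_sg_cases (k - 1) z.
    have e : (sg k * w = sg (k - 1) * (sg k * (sg (k - 1) * z)))%g.
      have := sg_braid (k - 1) n2; rewrite k1 => eb.
      by rewrite ev ez; have := congr1 (fun y => y * z)%g eb; rewrite -!mulgA => ->.
    have := len_sg_le (k - 1) (sg k * (sg (k - 1) * z))%g.
    have := len_sg_le k (sg (k - 1) * z)%g; rewrite -e; lia.
  rewrite k1 in h; rewrite ev ez !posw_sgmul.
  have -> : tau (k - 1) k = k - 1 by rewrite /tau k1 rfl_r //; apply: eqm_neq; lia.
  have -> : tau (k - 1) (k + 1) = k + 1 by apply: rflD; apply: eqm_neq; lia.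
  have -> : tau k (k - 1) = k - 1 by apply: rflD; apply: eqm_neq; lia.
  by have -> : tau k (k + 1) = k by rewrite /tau rfl_r ?eqmS.
(* The generators [sg q] and [sg k] commute here, so if [sg k] shortened v it would shorten w as
   well. *)
have l1 : (len v < len (sg k * v)%g)%N.
  have [->//|l1] := len_sg_cases k v.
  have e : (sg k * w = sg q * (sg k * v))%g.
    by rewrite ew !mulgA (sgC n2).
  by have := len_sg_le q (sg k * v)%g; rewrite -e; lia.
have h : posw v k < posw v (k + 1) by apply: IH; lia.
rewrite ew !posw_sgmul; have -> : tau q k = k by apply: rflD; rewrite // eqm_sym.
have -> // : tau q (k + 1) = k + 1 by apply: rflD; rewrite eqm_sym ?eqmDr.
Qed.

End Positions.

(** * Bruhat order and minimal representatives *)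

Section Bruhat.
Variable n : nat.
Hypothesis n_gt0 : (0 < n)%N.
Local Notation N := (n.+1%:Z).
Local Notation tau := (tau n).
Local Notation sg := (sg n).
Local Notation len := (@affA_length n).
Implicit Types (u : seq 'I_n.+1) (v w x y z t : affA n) (a b j k m : int).

Lemma len_descP k w : (len (sg k * w)%g < len w)%N = (posw w (k + 1) < posw w k).
Proof.
apply/idP/idP => [lt|lt].
  have := @len_asc n n_gt0 (sg k * w)%g k; rewrite sgK // => /(_ lt).
  by rewrite !posw_sgmul // /tau rfl_l rfl_r ?eqmS.
have [e|e] := len_sg_cases n_gt0 k w; last by lia.
by have := @len_asc n n_gt0 w k; rewrite e => /(_ (ltnSn _)); lia.
Qed.

Lemma posw_faithful x y : posw x = posw y -> x = y.
Proof.
suff H w : (forall j, posw w j = j) -> w = 1%g.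
  move=> e; apply/esym/eqP; rewrite -[y]mul1g -(mulgV x) -mulgA.
  by rewrite (H (x^-1 * y)%g) ?mulg1 // => j; rewrite posw_mul // -e posw_invK.
move=> h; apply/eqP; apply: contraT => /eqP /(len_desc n_gt0)[k].
by rewrite len_descP !h; lia.
Qed.

(** Follow a and b along the word. Some letter reverses the order of their images; by [tau_inv] it
    exchanges these images, so deleting it amounts to precomposing with the reflection. *)
Lemma exchange u a b : a < b -> pos u b < pos u a ->
  exists u', (size u' < size u)%N /\ pos u' = pos u \o rfl n a b.
Proof.
elim: u a b => [|c u IH] a b ab /=; first by lia.
move=> lt; have [h|h] := ltP (tau (c : nat) a) (tau (c : nat) b).
  have [u' [s e]] := IH _ _ h lt; exists (c :: u'); split=> //.
  apply: funext => j /=; rewrite e /= -(@rfl_conj n (tau (c : nat))) //.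
    by move=> i t; apply: rfl_aff.
  exact: tau_inj.
have {}h : tau (c : nat) b < tau (c : nat) a.
  rewrite lt_neqAle h andbT; apply/eqP => /tau_inj e; have := e n_gt0; lia.
exists u; split=> //; apply: funext => j /=.
by rewrite (tau_inv n_gt0 ab h) tauK.
Qed.

Lemma refl_down t v a b : a < b -> posw t = rfl n a b ->
  posw v b < posw v a -> (len (t * v)%g < len v)%N.
Proof.
move=> ab et lt; have [u [eu <-]] := len_ex v.
have [] := @exchange u a b ab; first by rewrite -posw_word // eu.
move=> u' [s e]; apply: leq_ltn_trans s; suff -> : (t * v)%g = affA_word u' by apply: len_word.
apply: posw_faithful; apply: funext => j.
by rewrite posw_mul // et -eu !posw_word // e.
Qed.

Lemma rflC a b : eqm n a b = false -> rfl n a b = rfl n b a.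
Proof.
move=> h; apply: funext => j; rewrite /rfl; case: ifP => // ja.
by case: ifP => // jb; move: h; rewrite (eqm_trans _ jb) // eqm_sym.
Qed.

Lemma refl_ex t : is_reflection t ->
  exists a b, [/\ a < b, eqm n a b = false & posw t = rfl n a b].
Proof.
move=> [x [k ->]]; pose F := posw (x^-1)%g.
have e : posw (x * affA_gen n k * x^-1)%g = rfl n (F k) (F (k%:Z + 1)).
  apply: funext => j; rewrite !posw_mul // sg_nat posw_sg // /tau.
  rewrite -/F (@rfl_conj n F) /F ?posw_Kinv //; first by move=> *; apply: posw_aff.
  exact: posw_inj.
have ne : eqm n (F k) (F (k%:Z + 1)) = false.
  apply/negP => /eqmP[t']; rewrite /F -posw_aff // => /(posw_inj n_gt0) h.
  have : eqm n k (k%:Z + 1) by apply/eqmP; exists t'.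
  by rewrite eqmS.
have [h|h] : F k < F (k%:Z + 1) \/ F (k%:Z + 1) < F k.
    have : F k <> F (k%:Z + 1) by move=> E; rewrite E eqmxx in ne.
    by lia.
  by exists (F k), (F (k%:Z + 1)).
by exists (F (k%:Z + 1)), (F k); rewrite eqm_sym ne -rflC.
Qed.

Lemma refl_up t v a b : a < b -> posw t = rfl n a b ->
  (len v < len (t * v)%g)%N -> posw v a < posw v b.
Proof.
move=> ab et lt; have [//|] := ltP (posw v a) (posw v b).
rewrite le_eqVlt => /orP[/eqP/(posw_inj n_gt0)|/(refl_down ab et)]; lia.
Qed.

Lemma refl_upV t v a b : a < b -> eqm n a b = false -> posw t = rfl n a b ->
  posw v a < posw v b -> (len v < len (t * v)%g)%N.
Proof.
move=> ab nab et lt.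
have := @refl_down t (t * v)%g a b ab et; rewrite !posw_mul // et rfl_l rfl_r // => /(_ lt).
suff -> : (t * (t * v))%g = v by [].
by apply: posw_faithful; apply: funext => j; rewrite !posw_mul // et rflK.
Qed.

Lemma refl_conj t x : is_reflection t -> is_reflection (x * t * x^-1)%g.
Proof.
by move=> [y [k ->]]; exists (x * y)%g, k; rewrite invgM !mulgA.
Qed.

Lemma refl_sg k : is_reflection (sg k).
Proof. by exists 1%g, (absz (k %% N)%Z); rewrite invg1 mulg1 mul1g. Qed.

(** The definition of [bruhat_le] multiplies by reflections on the right, whereas positions are
    permuted by left factors; conjugation by v passes between the two. *)
Lemma bruhat_left x v t : bruhat_le x v -> is_reflection t ->
  (len v < len (t * v)%g)%N -> bruhat_le x (t * v)%g.
Proof.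
move=> xv rt lt; have e : (t * v = v * (v^-1 * t * v))%g by rewrite !mulgA mulgV mul1g.
rewrite e; apply: bruhat_step => //; last by rewrite -e.
by have := refl_conj v^-1%g rt; rewrite invgK.
Qed.

Lemma bruhat_ind_left (P : affA n -> affA n -> Prop) :
    (forall w, P w w) ->
    (forall x v t a b, a < b -> eqm n a b = false -> posw t = rfl n a b ->
       is_reflection t -> posw v a < posw v b -> P x v -> P x (t * v)%g) ->
  forall x y, bruhat_le x y -> P x y.
Proof.
move=> P0 P1 x y; elim=> // {}x v t _ IH rt lt.
have e : (v * t = (v * t * v^-1) * v)%g by rewrite -!mulgA mulVg mulg1.
have rt' := refl_conj v rt; have [a [b [ab nab et]]] := refl_ex rt'.
rewrite e; apply: (P1 _ _ _ a b) => //; apply: (refl_up ab et).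
by rewrite -e.
Qed.

Lemma bruhat_trans x y z : bruhat_le x y -> bruhat_le y z -> bruhat_le x z.
Proof. by move=> xy yz; elim: yz x xy => // {}y v t _ IH rt lt x /IH h; apply: bruhat_step. Qed.

Lemma bruhat_len x y : bruhat_le x y -> (len x <= len y)%N.
Proof. by elim=> // {}x v t _ IH _ lt; apply: leq_trans IH (ltnW lt). Qed.

Lemma bruhat_up k v : (len v < len (sg k * v)%g)%N -> bruhat_le v (sg k * v)%g.
Proof. by move=> lt; apply: bruhat_left => //; [apply: bruhat_refl | apply: refl_sg]. Qed.

(** The lifting property, checked on one step from v to [t * v]. If [tau k] preserves the order of a
    < b, the conjugate of t steps up from [sg k * v]. Otherwise t is [sg k], and the bound by
    [sg k * v] is already the one wanted. *)
Lemma bruhat_sg k x y : bruhat_le x y ->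
  bruhat_le (sg k * x)%g y \/ bruhat_le (sg k * x)%g (sg k * y)%g.
Proof.
move: x y; apply: bruhat_ind_left => [w|x v t a b ab nab et rt lt IH].
  by right; apply: bruhat_refl.
have ltv := refl_upV ab nab et lt.
case: IH => [h|h]; first by left; apply: bruhat_left.
have [h1|h1] := ltP (tau k a) (tau k b).
  right; have -> : (sg k * (t * v) = (sg k * t * (sg k)^-1) * (sg k * v))%g.
    by rewrite sgV // -!mulgA sgK.
  apply: bruhat_left => //; first exact: refl_conj.
  apply: (@refl_upV _ _ (tau k a) (tau k b)) => //.
  - apply/negP => /eqmP[s]; rewrite -rfl_aff => /(tau_inj n_gt0) e.
    by move: nab; rewrite e eqm_shift eqmxx.
  - apply: funext => j; rewrite sgV // !posw_mul // !posw_sg // et.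
    rewrite (@rfl_conj n (tau k)) ?tauK //; first by move=> *; apply: rfl_aff.
    exact: tau_inj.
  - by rewrite !posw_sgmul // !tauK.
have {}h1 : tau k b < tau k a.
  by rewrite lt_neqAle h1 andbT; apply/eqP => /(tau_inj n_gt0); lia.
left; suff -> : t = sg k by [].
by apply: posw_faithful; rewrite et posw_sg // (tau_inv n_gt0 ab h1).
Qed.

Lemma bruhat_lift k x y : bruhat_le x y -> (len y < len (sg k * y)%g)%N ->
  bruhat_le (sg k * x)%g (sg k * y)%g.
Proof.
by move=> /(bruhat_sg k)[h|//] lt; apply: bruhat_trans h (bruhat_up lt).
Qed.

(* The cosets w W_S correspond to the functions [lev 1 w]; other offsets m give the
   cosets of the parabolic subgroup generated by all s_k but s_(m - 1). *)
Definition lev m w j : int := ((posw w j - m) %/ N)%Z.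

Lemma lev_aff m w : aff n (lev m w).
Proof. by move=> j t; rewrite /lev posw_aff // (aff_floor n_gt0 m (posw w j) t). Qed.

Lemma lev_sg m k w : lev m (sg k * w)%g = lev m w \o tau k.
Proof. by apply: funext => j; rewrite /lev posw_sgmul. Qed.

Lemma lev_mul m t w a b : posw t = rfl n a b -> lev m (t * w)%g = lev m w \o rfl n a b.
Proof. by move=> et; apply: funext => j; rewrite /lev posw_mul // et. Qed.

Lemma lev_mono m w a b : posw w a <= posw w b -> lev m w a <= lev m w b.
Proof. by move=> h; apply: lez_pdiv2r => //; lia. Qed.

Lemma bruhat_fle m x y : bruhat_le x y -> fle n (lev m x) (lev m y).
Proof.
move: x y; apply: bruhat_ind_left => [w|x v t a b ab nab et rt lt IH].
  exact: fle_refl.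
rewrite (lev_mul _ _ et); apply: fle_trans IH _; apply: fle_rfl => //.
  exact: lev_aff.
by apply: lev_mono; apply: ltW.
Qed.

Lemma floorS (x' : int) : eqm n (x' + 1) 0 = false -> ((x' + 1) %/ N = x' %/ N)%Z.
Proof.
move=> h; have e := divz_eq x' N.
have h0 : 0 <= (x' %% N)%Z by rewrite modz_ge0.
have h1 : (x' %% N)%Z < N by rewrite ltz_pmod.
move: (x' %/ N)%Z (x' %% N)%Z e h0 h1 => q r e h0 h1.
have {}h1 : r + 1 < N.
  rewrite lt_neqAle; apply/andP; split; last by lia.
  apply/eqP => E; move: h; rewrite e.
  have -> : q * N + r + 1 = 0 + (q + 1) * N by lia.
  by rewrite eqm_shift eqmxx.
have -> : x' + 1 = q * N + (r + 1) by lia.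
by rewrite divzMDl // (@floor_small n); lia.
Qed.

(** The floor cuts Z into blocks of length n + 1, one of them starting at m; only swaps at k
    congruent to m - 1 cross a boundary. *)
Lemma floor_tau m k j : eqm n k (m - 1) = false ->
  ((tau k j - m) %/ N = (j - m) %/ N)%Z.
Proof.
move=> h.
have E : ((k + 1 - m) %/ N = (k - m) %/ N)%Z.
  have -> : k + 1 - m = k - m + 1 by lia.
  apply: floorS; apply/negP => /eqmP[t e]; move/negP: h; apply; apply/eqmP.
  by exists t; lia.
case j1: (eqm n j k).
  move/eqmP: j1 => [t ->]; rewrite /tau rflL.
  have -> : k + 1 + t * N - m = t * N + (k + 1 - m) by lia.
  have -> : k + t * N - m = t * N + (k - m) by lia.
  by rewrite !divzMDl // E.
case j2: (eqm n j (k + 1)); last by rewrite /tau rflD.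
move/eqmP: j2 => [t ->]; rewrite /tau rflR ?eqmS //.
have -> : k + 1 + t * N - m = t * N + (k + 1 - m) by lia.
have -> : k + t * N - m = t * N + (k - m) by lia.
by rewrite !divzMDl // E.
Qed.

Lemma lev_avoid u b : {in u, forall a : 'I_n.+1, eqm n (a : nat) b = false} ->
  lev (b + 1) (affA_word u) = fun j => ((j - (b + 1)) %/ N)%Z.
Proof.
move=> av; apply: funext => j; rewrite /lev posw_word //; elim: u j av => //= a u IH j av.
rewrite IH ?floor_tau //.
  have -> : b + 1 - 1 = b by lia.
  by apply: av; rewrite mem_head.
by move=> c hc; apply: av; rewrite inE hc orbT.
Qed.

(** The offset of [lev] serves this purpose. A word without s_b has the level function of the
    identity at offset b + 1, with no bead from b + 1 on, whereas [sg b] has a bead at b + 1. *)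
Lemma avoid_bruhat u b : {in u, forall a : 'I_n.+1, eqm n (a : nat) b = false} ->
  ~ bruhat_le (sg b) (affA_word u).
Proof.
move=> av /(bruhat_fle (b + 1)) /(_ (b + 1)); rewrite (lev_avoid av).
rewrite beadsS; last exact: lev_aff.
rewrite {2}/beads big1_seq => [|x /andP[_ /mem_win[i hi ->]]].
  rewrite {2}/lev posw_sg // /tau rfl_r ?eqmS //.
  have -> : b - (b + 1) = (- 1) * N + n%:Z by lia.
  by rewrite divzMDl // floor_small //; lia.
by rewrite floor_small //; lia.
Qed.

(** * Cosets of W_S as cores, and coefficients of the Poincaré polynomial *)

Local Notation Lw := (lev 1).

Lemma Lw1 : Lw 1%g = base n.
Proof. by apply: funext => j; rewrite /lev posw1. Qed.

Lemma core_Lw w : core n (Lw w).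
Proof.
have [u [<- _]] := len_ex w; elim: u => [|a u IH].
  by rewrite [affA_word _]/(1%g : affA n) Lw1; apply: core_base.
by rewrite word_cons lev_sg; apply: core_tau.
Qed.

Lemma ell_len w : (ell n (Lw w) <= len w)%N.
Proof.
have [u [<- <-]] := len_ex w; elim: u => [|a u IH].
  by rewrite [affA_word _]/(1%g : affA n) Lw1 ell_base.
rewrite word_cons lev_sg; have := ell_tau n_gt0 (a : nat) (lev_aff 1 (affA_word u)).
by rewrite /=; do 2!case: ltP; lia.
Qed.

(** Removing descents one by one lowers [ell] by one per generator and ends at [base]. This spells
    an element of length at most [ell n L], and [ell_len] shows that no element of the coset is
    shorter. *)
Lemma len_rep L : core n L -> exists w, Lw w = L /\ len w = ell n L.
Proof.
have [m] := ubnP (ell n L); elim: m L => // m IH L lem cL.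
have [->|/(core_desc n_gt0 cL)[k dk]] := EM (L = base n).
  by exists 1%g; rewrite Lw1 len1 ell_base.
have e := ell_tau n_gt0 k cL.1; rewrite dk ltNge (ltW dk) /= in e.
have [||w [ew lw]] := IH (L \o tau k); [by lia | exact: core_tau |].
exists (sg k * w)%g; have eL : Lw (sg k * w)%g = L.
  by rewrite lev_sg ew; apply: funext => j /=; rewrite tauK.
split=> //; have := ell_len (sg k * w)%g; rewrite eL.
by have := len_sg_le n_gt0 k w; lia.
Qed.

Lemma base_tau k : eqm n k 0 = false -> base n \o tau k = base n.
Proof. by move=> h; apply: funext => j; apply: floor_tau; rewrite subrr. Qed.

Lemma in_WS_base x : in_WS x <-> Lw x = base n.
Proof.
split=> [[ks [h ->]]|].
  elim: ks h => [|k ks IH] /=; first by rewrite big_nil Lw1.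
  move=> /andP[hk /IH h]; rewrite big_cons sg_nat lev_sg h base_tau //.
  by apply: eqm_neq; lia.
have [m] := ubnP (len x); elim: m x => // m IH x lem ex.
have [->|/(len_desc n_gt0)[k dk]] := EM (x = 1%g).
  by exists [::]; rewrite big_nil.
have [a [ea1 ea2]] := sg_ex n_gt0 k; have esa : sg k = affA_gen n a.
  by rewrite sg_nat; apply: sg_eqm.
(* A descent at k congruent to 0 would make the level at k + 1 at most the level at k, but [base]
   jumps up there. *)
have nk : eqm n k 0 = false.
  apply/negP => /eqmP[t et]; move: dk; rewrite len_descP => /ltW /(lev_mono 1).
  rewrite ex /base et; have -> : 0 + t * N + 1 - 1 = t * N + 0 by lia.
  have -> : 0 + t * N - 1 = (t - 1) * N + n%:Z by lia.
  by rewrite !divzMDl // div0z floor_small; lia.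
have [||ks [h1 h2]] := IH (sg k * x)%g.
- by lia.
- by rewrite lev_sg ex base_tau.
exists ((a : nat) :: ks); split.
  rewrite /= h1 andbT; have := ltn_ord a; case: (posnP a) => [a0|]; last by lia.
  by rewrite a0 nk in ea2.
by rewrite big_cons -h2 -esa sgK.
Qed.

Lemma Lw_mulS w x : in_WS x -> Lw (w * x)%g = Lw w.
Proof.
move=> /in_WS_base e; apply: funext => j; rewrite /lev posw_mul //.
exact: (congr1 (fun F : int -> int => F (posw w j)) e).
Qed.

Lemma in_WS_div x y : Lw x = Lw y -> in_WS (x^-1 * y)%g.
Proof.
move=> e; apply/in_WS_base; apply: funext => j; rewrite /lev posw_mul //.
by rewrite -[LHS]/(Lw y (posw x^-1%g j)) -e /lev posw_invK.
Qed.

Lemma min_repP w : is_min_rep w <-> len w = ell n (Lw w).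
Proof.
split=> [h|h x hx]; last by rewrite h -(Lw_mulS w hx) ell_len.
have [x [ex lx]] := len_rep (core_Lw w).
have := h _ (in_WS_div (esym ex)); rewrite mulgA mulgV mul1g lx.
by have := ell_len w; lia.
Qed.

Lemma min_rep_ex L : core n L -> exists w, is_min_rep w /\ Lw w = L.
Proof. by move=> /len_rep[w [e l]]; exists w; split=> //; apply/min_repP; rewrite e. Qed.

Lemma min_rep_down w k : is_min_rep w -> Lw w (k + 1) < Lw w k ->
  is_min_rep (sg k * w)%g /\ len w = (len (sg k * w)%g).+1.
Proof.
move=> /min_repP mw dk; have e := ell_tau n_gt0 k (lev_aff 1 w).
rewrite dk ltNge (ltW dk) /= in e.
have lt : (len (sg k * w)%g < len w)%N.
  by rewrite len_descP ltNge; apply/negP => /(lev_mono 1); lia.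
have := len_sg_cases n_gt0 k w => c; split; last by lia.
by apply/min_repP; rewrite lev_sg; lia.
Qed.

Lemma min_rep_step v : is_min_rep v -> (0 < len v)%N ->
  exists k, [/\ Lw v (k + 1) < Lw v k, is_min_rep (sg k * v)%g & len v = (len (sg k * v)%g).+1].
Proof.
move=> mv lv; have nb : Lw v <> base n.
  by move=> e; move/min_repP: mv; rewrite e ell_base //; lia.
have [k dk] := core_desc n_gt0 (core_Lw v) nb.
by have [h1 h2] := min_rep_down mv dk; exists k.
Qed.

Lemma min_rep_uniq x y : is_min_rep x -> is_min_rep y -> Lw x = Lw y -> x = y.
Proof.
have [m] := ubnP (len x); elim: m x y => // m IH x y lem mx my e.
have [eb|/(core_desc n_gt0 (core_Lw x))[k dk]] := EM (Lw x = base n).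
  move/min_repP: mx; move/min_repP: my; rewrite -e eb (ell_base n_gt0).
  by move=> /len_eq0 -> /len_eq0 ->.
have [mx' lx] := min_rep_down mx dk; rewrite e in dk; have [my' ly] := min_rep_down my dk.
have : (sg k * x)%g = (sg k * y)%g by apply: IH => //; [lia | rewrite !lev_sg e].
by move/(congr1 (fun z => sg k * z)%g); rewrite !sgK.
Qed.

Lemma fle_base L : core n L -> fle n L (base n) -> L = base n.
Proof.
move=> cL /(_ 1); rewrite {2}/beads (win_base n_gt0) big1_seq => [|x /andP[_ /nseqP[-> _]]] //.
rewrite leqn0 /beads sum_nat_seq_eq0 => /allP h.
have W0 : {in win n L 1, forall i : int, i = 0}.
  by apply: sum_eq0 cL.2 => x /h /=; rewrite /negp; case: ltP; lia.
apply: (aff_eq_win (j := 1) cL.1 (aff_base n_gt0)) => i hi.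
rewrite /base floor_small; last by lia.
by apply: W0; apply/mem_win; exists i.
Qed.

(** Induction along a descent k of y. If x also descends at k, strip it from both and restore it
    with [bruhat_lift]; if not, containment survives stripping it from y alone. The lifting lemmas
    for cores provide both containments. *)
Lemma fle_bruhat x y : is_min_rep x -> is_min_rep y -> fle n (Lw x) (Lw y) -> bruhat_le x y.
Proof.
have [m] := ubnP (len y); elim: m x y => // m IH x y lem mx my xy.
have [eb|/(core_desc n_gt0 (core_Lw y))[k dk]] := EM (Lw y = base n).
  have ex : Lw x = base n by apply: fle_base (core_Lw x) _; rewrite -eb.
  by rewrite (min_rep_uniq mx my) ?ex //; apply: bruhat_refl.
have [my' ly] := min_rep_down my dk.
have ey : y = (sg k * (sg k * y))%g by rewrite sgK.
have up : (len (sg k * y)%g < len (sg k * (sg k * y))%g)%N by rewrite sgK //; lia.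
have [hx|hx] := leP (Lw x k) (Lw x (k + 1)).
  rewrite ey; apply: bruhat_trans (bruhat_up up); apply: IH => //; first by lia.
  by rewrite lev_sg; apply: fle_tauR => //; apply: lev_aff.
have [mx' lx] := min_rep_down mx hx.
rewrite ey -[x](sgK n_gt0 k); apply: bruhat_lift => //.
apply: IH => //; first by lia.
rewrite !lev_sg; have ax := lev_aff 1 x; have ay := lev_aff 1 y.
apply: fle_tauR => //; first exact: aff_rfl.
  by apply: fle_tauL => //; apply: ltW.
by rewrite /= /tau rfl_l rfl_r ?eqmS // ltW.
Qed.

Lemma coset_leP x y : coset_le x y <-> fle n (Lw x) (Lw y).
Proof.
split=> [[p [q [hp hq mp mq]]]|h].
  by move=> /(bruhat_fle 1); rewrite !Lw_mulS.
have [x' [mx ex]] := min_rep_ex (core_Lw x); have [y' [my ey]] := min_rep_ex (core_Lw y).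
exists (x^-1 * x')%g, (y^-1 * y')%g; rewrite !mulgA !mulgV !mul1g; split=> //.
- by apply: in_WS_div; rewrite ex.
- by apply: in_WS_div; rewrite ey.
by apply: fle_bruhat => //; rewrite ex ey.
Qed.

Lemma fle_ell L M : core n L -> core n M -> fle n L M -> (ell n L <= ell n M)%N.
Proof.
move=> /min_rep_ex[x [mx <-]] /min_rep_ex[y [my <-]] h.
move/min_repP: (mx) => <-; move/min_repP: (my) => <-.
by apply: bruhat_len; apply: fle_bruhat.
Qed.

Definition pcount w (i : nat) : nat :=
  size [seq v <- fset_set (poincare_set w) | len v == i].

Lemma coef_poincare w i : (poincare_poly w)`_i = (pcount w i)%:Z.
Proof.
rewrite /poincare_poly /pcount coef_sum size_filter -sum1_count.
rewrite [RHS](big_morph Posz PoszD (erefl _)) [RHS]big_mkcond /=.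
by apply: eq_bigr => v _; rewrite coefXn eq_sym; case: eqP.
Qed.

Lemma palindromicP w :
  palindromic w <-> forall i, (i <= len w)%N -> pcount w i = pcount w (len w - i)%N.
Proof.
by split=> h i /h; rewrite !coef_poincare; [case | move->].
Qed.

Lemma mem_poincare w v : (v \in fset_set (poincare_set w)) <-> is_min_rep v /\ bruhat_le v w.
Proof.
rewrite in_fset_set; last exact: poincare_set_finite.
by rewrite inE.
Qed.

Lemma pcount_ge w i (s : seq (affA n)) : uniq s ->
    (forall v, v \in s -> [/\ is_min_rep v, bruhat_le v w & len v = i]) ->
  (size s <= pcount w i)%N.
Proof.
move=> us hs; apply: uniq_leq_size => // v /hs[h1 h2 h3].
by rewrite mem_filter h3 eqxx; apply/mem_poincare.
Qed.

Lemma pcount_le w i (s : seq (affA n)) :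
    (forall v, is_min_rep v -> bruhat_le v w -> len v = i -> v \in s) ->
  (pcount w i <= size s)%N.
Proof.
move=> hs; apply: uniq_leq_size; first by rewrite filter_uniq // fset_uniq.
by move=> v; rewrite mem_filter => /andP[/eqP l /mem_poincare[h1 h2]]; apply: hs.
Qed.

End Bruhat.

(** * Palindromic elements *)

Section WindowLength.
Variable n : nat.
Implicit Types (L M : int -> int) (a b p : int) (s : seq int).

Lemma ells_split s1 s2 s3 : exists K : nat, forall a b : int,
  ells (s1 ++ a :: s2 ++ b :: s3) = (K + phi a b
    + \sum_(x <- s1) (phi x a + phi x b) + \sum_(x <- s2) (phi a x + phi x b)
    + \sum_(x <- s3) (phi a x + phi b x))%N.
Proof.
exists (ells s1 + ells s2 + ells s3 + \sum_(x <- s1) \sum_(y <- s2) phi x y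
  + \sum_(x <- s1) \sum_(y <- s3) phi x y + \sum_(x <- s2) \sum_(y <- s3) phi x y)%N.
move=> a b; rewrite ells_cat /= ells_cat /= !big_cat /= !big_cons.
have -> : (\sum_(x <- s1) \sum_(y <- a :: s2 ++ b :: s3) phi x y =
  \sum_(x <- s1) phi x a + \sum_(x <- s1) phi x b +
  \sum_(x <- s1) \sum_(y <- s2) phi x y + \sum_(x <- s1) \sum_(y <- s3) phi x y)%N.
  rewrite -!big_split /=; apply: eq_bigr => x _.
  by rewrite big_cons big_cat big_cons /=; lia.
have -> : (\sum_(x <- s2) \sum_(y <- b :: s3) phi x y =
  \sum_(x <- s2) phi x b + \sum_(x <- s2) \sum_(y <- s3) phi x y)%N.
  by rewrite -!big_split /=; apply: eq_bigr => x _; rewrite big_cons.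
by rewrite !big_split /=; lia.
Qed.

(** The order conditions make the joint contribution of the two marked entries against any third one
    unchanged. Only their mutual term moves, from b - a - 1 to b - a - 2. *)
Lemma ells_pair s1 s2 s3 a b : {in s1, forall x, x < a} ->
    {in s2, forall x, a <= x <= b} -> {in s3, forall x, b < x} -> a + 2 <= b ->
  ells (s1 ++ a :: s2 ++ b :: s3) = (ells (s1 ++ (b - 1)%R :: s2 ++ (a + 1)%R :: s3)).+1.
Proof.
move=> h1 h2 h3 ab; have [K E] := ells_split s1 s2 s3; rewrite !E.
have -> : phi a b = (phi (b - 1) (a + 1)).+1 by rewrite /phi; do 2!case: ifP; lia.
rewrite addnS !addSn; congr (_ + _ + _ + _).+1; apply: eq_big_seq => x.
- by move=> /h1; rewrite /phi; do 4!case: ifP; lia.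
- by move=> /h2; rewrite /phi; do 4!case: ifP; lia.
- by move=> /h3; rewrite /phi; do 4!case: ifP; lia.
Qed.

(** Again only the mutual term of the two ends changes, from b - a - 2 to b - a - 3. This is the
    length count for the third core of [three_cocoatoms]. *)
Lemma ells_swap_ends s a b : {in s, forall x, (x == a) || (x == b)} -> a + 3 <= b ->
  ells ((b - 1) :: s ++ [:: a + 1]) = (ells ((a + 1)%R :: s ++ [:: b - 1]%R)).+1.
Proof.
move=> h ab; have [K /= E] := ells_split [::] s [::]; have E1 := E (b - 1) (a + 1); have E2 := E (a + 1) (b - 1).
rewrite [LHS]E1 [in RHS]E2.
have -> : phi (b - 1) (a + 1) = (phi (a + 1) (b - 1)).+1.
  by rewrite /phi; do 2!case: ifP; lia.
rewrite addnS !addSn !big_nil; congr (_ + _ + _ + _).+1; apply: eq_big_seq => x.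
by move=> /h /orP[/eqP ->|/eqP ->]; rewrite /phi; do 4!case: ifP; lia.
Qed.

Definition seg L p (i m : nat) : seq int := [seq L (p + l%:Z) | l <- iota i m].

Lemma win_split L p (i j : nat) : (i < j)%N -> (j <= n)%N ->
  win n L p = seg L p 0 i ++ L (p + i%:Z) :: seg L p i.+1 (j - i.+1) ++
    L (p + j%:Z) :: seg L p j.+1 (n - j).
Proof.
move=> ij jn; rewrite /win; have -> : n.+1 = (i + (1 + ((j - i.+1) + (1 + (n - j)))))%N by lia.
rewrite !iotaD !map_cat /=; congr (_ ++ _ :: _ ++ _ :: _) => //.
- by rewrite /seg add0n addn1.
- by congr (L (p + Posz _)); lia.
- by rewrite /seg; congr (map _ (iota _ _)); lia.
Qed.

Lemma seg_eq L M p (i m : nat) :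
  (forall l, (i <= l < i + m)%N -> L (p + l%:Z) = M (p + l%:Z)) ->
  seg L p i m = seg M p i m.
Proof. by move=> h; apply/eq_in_map => l; rewrite mem_iota => /h. Qed.

Lemma segP L p (i m : nat) x : x \in seg L p i m ->
  exists2 l, (i <= l < i + m)%N & x = L (p + l%:Z).
Proof. by move=> /mapP[l]; rewrite mem_iota => h ->; exists l. Qed.

Lemma fle_rfl_down L a b : aff n L -> a < b -> eqm n a b = false -> L b <= L a ->
  fle n (L \o rfl n a b) L.
Proof.
move=> aL ab nab h; have := @fle_rfl n (L \o rfl n a b) a b (aff_rfl _ _ aL) ab nab.
rewrite /= rfl_l rfl_r // => /(_ h).
suff -> : (L \o rfl n a b) \o rfl n a b = L by [].
by apply: funext => j; rewrite /= rflK.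
Qed.

End WindowLength.

(** * Shapes forced by a palindromic Poincaré polynomial *)

Section Obstruction.
Variable n : nat.
Hypothesis n_gt1 : (1 < n)%N.
Let n_gt0 : (0 < n)%N := ltnW n_gt1.
Local Notation N := (n.+1%:Z).
Local Notation tau := (tau n).
Local Notation sg := (sg n).
Local Notation len := (@affA_length n).
Local Notation Lw := (lev 1).
Implicit Types (L M : int -> int) (w v : affA n) (a b k r p : int).

Lemma base_flat k : eqm n k 0 = false -> base n (k + 1) = base n k.
Proof.
move=> /(base_tau n_gt0) /(congr1 (fun F : int -> int => F k)).
by rewrite /= /tau rfl_l.
Qed.

Lemma min_rep_len1 v : is_min_rep v -> len v = 1%N -> v = sg 0.
Proof.
move=> mv lv; have [|k [dk _]] := min_rep_step n_gt0 mv; first by lia.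
rewrite lv => -[] /esym /len_eq0 e.
have ev : v = sg k by rewrite -[v](sgK n_gt0 k) e mulg1.
rewrite ev; apply: sg_eqm => //; apply: contraT => /negbTE h.
have := base_flat h; move: dk; rewrite ev -[sg k]mulg1 lev_sg // Lw1 // base_tau //; lia.
Qed.

Lemma pcount1 w : (pcount w 1 <= 1)%N.
Proof.
apply: (@pcount_le n w 1 [:: sg 0]) => v mv _ lv.
by rewrite inE (min_rep_len1 mv lv).
Qed.

Lemma pcount2 w : (pcount w 2 <= 2)%N.
Proof.
apply: (@pcount_le n w 2 [:: sg 1 * sg 0; sg (- 1) * sg 0]%g) => v mv _ lv.
have [|k [dk mv' l']] := min_rep_step n_gt0 mv; first by lia.
have e0 : (sg k * v)%g = sg 0 by apply: min_rep_len1 => //; lia.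
have ev : v = (sg k * sg 0)%g by rewrite -[v](sgK n_gt0 k) e0.
case k0: (eqm n k 0); first by move: lv; rewrite ev (sg_eqm k0) sg2 // len1.
case k1: (eqm n k 1); first by rewrite ev (sg_eqm k1) mem_head.
case k2: (eqm n k (- 1)); first by rewrite ev (sg_eqm k2) !inE eqxx orbT.
have := base_flat k0; move: dk.
rewrite ev lev_sg // -[sg 0]mulg1 lev_sg // Lw1 //= /tau rfl_l rfl_r ?eqmS //.
rewrite !rflD //; first by lia.
- by rewrite -(eqmDr n (- 1)); have -> : k + 1 - 1 = k by lia.
- by rewrite -(eqmDr n (- 1)); have -> : k + 1 - 1 = k by lia.
Qed.

(** Lower bounds on coefficients are produced as lists of explicit cores. These are functions
    compared by propositional equality, hence [List.In] and [List.NoDup]; minimal representatives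
    are chosen only here. *)
Lemma core_list_pcount w (i : nat) (Ms : seq (int -> int)) :
    (forall M, List.In M Ms -> [/\ core n M, fle n M (Lw w) & ell n M = i]) ->
    List.NoDup Ms -> is_min_rep w ->
  (size Ms <= pcount w i)%N.
Proof.
move=> hM nd mw.
have [s [es hs]] : exists s : seq (affA n), map (lev 1) s = Ms /\
    {in s, forall v, is_min_rep v}.
  elim: Ms hM {nd} => [|M Ms IH] hM; first by exists [::].
  have [|s [es hs]] := IH; first by move=> M' h; apply: hM; right.
  have [cM _ _] := hM M (or_introl erefl).
  have [v [mv ev]] := min_rep_ex n_gt0 cM.
  exists (v :: s); rewrite /= ev es; split=> // x; rewrite inE => /orP[/eqP ->//|].
  exact: hs.
have inM v : v \in s -> List.In (Lw v) Ms.
  by rewrite -es; elim: (s) => //= x s' IH; rewrite inE => /orP[/eqP ->|/IH]; [left|right].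
rewrite -es size_map; apply: pcount_ge => // [|v vs].
  move: nd; rewrite -es; elim: (s) => //= x s' IH nd; inversion_clear nd.
  rewrite IH // andbT; apply/negP => xs; case: H.
  by elim: (s') xs => //= y s'' IH'; rewrite inE => /orP[/eqP ->|/IH']; [left|right].
have [cM fM lM] := hM _ (inM v vs); split; first exact: hs.
  by apply: fle_bruhat => //; apply: hs.
by rewrite (min_repP n_gt0 v).1 //; apply: hs.
Qed.

Lemma palindromic_coatoms w M1 M2 : is_min_rep w -> palindromic w ->
  (forall M, M = M1 \/ M = M2 -> [/\ core n M, fle n M (Lw w) & (ell n M).+1 = ell n (Lw w)]) ->
  M1 = M2.
Proof.
move=> mw /palindromicP pal h; apply: contrapT => ne.
have lw := (min_repP n_gt0 w).1 mw.
have [_ _ l1] := h M1 (or_introl erefl).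
have := @core_list_pcount w (len w - 1) [:: M1; M2].
rewrite -pal; last by lia.
have p1 := pcount1 w => H; suff: (2 <= pcount w 1)%N by lia.
apply: H => //.
  move=> M HM; have [c1 c2 c3] : [/\ core n M, fle n M (Lw w) & (ell n M).+1 = ell n (Lw w)].
    by apply: h; case: HM => [|[|[]]] ->; [left|right].
  by split=> //; lia.
constructor; first by case=> // e; case: ne.
by constructor; [case | constructor].
Qed.

Lemma palindromic_cocoatoms w M1 M2 M3 : is_min_rep w -> palindromic w ->
  (forall M, [\/ M = M1, M = M2 | M = M3] ->
     [/\ core n M, fle n M (Lw w) & (ell n M).+2 = ell n (Lw w)]) ->
  [\/ M1 = M2, M1 = M3 | M2 = M3].
Proof.
move=> mw /palindromicP pal h; apply: contrapT => ne.
have lw := (min_repP n_gt0 w).1 mw.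
have [_ _ l1] := h M1 (Or31 _ _ erefl).
have := @core_list_pcount w (len w - 2) [:: M1; M2; M3].
rewrite -pal; last by lia.
have p1 := pcount2 w => H; suff: (3 <= pcount w 2)%N by lia.
apply: H => //.
  move=> M HM; have [c1 c2 c3] : [/\ core n M, fle n M (Lw w) & (ell n M).+2 = ell n (Lw w)].
    by apply: h; case: HM => [|[|[|[]]]] ->; [apply: Or31|apply: Or32|apply: Or33].
  by split=> //; lia.
constructor; first by case=> [e|[e|//]]; apply: ne; [apply: Or31|apply: Or32].
constructor; first by case=> [e|//]; apply: ne; apply: Or33.
by constructor; [case | constructor].
Qed.

Lemma tau_fle L k : aff n L -> L (k + 1) <= L k -> fle n (L \o tau k) L.
Proof. by move=> aL h; apply: fle_rfl_down; rewrite ?eqmS //; lia. Qed.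

Lemma ell_tau_down L k : aff n L -> L (k + 1) < L k -> (ell n (L \o tau k)).+1 = ell n L.
Proof. by move=> aL h; have := ell_tau n_gt0 k aL; rewrite h ltNge (ltW h) /=; lia. Qed.

(** A second descent would give a second core one step below w. The two differ at r, where only
    [Lw w \o tau r] has a level below [Lw w r]. *)
Lemma palindromic_desc w r k : is_min_rep w -> palindromic w ->
  Lw w (r + 1) < Lw w r -> eqm n k r = false -> Lw w k <= Lw w (k + 1).
Proof.
move=> mw pal dr nkr; rewrite leNgt; apply/negP => dk.
have cL := core_Lw n_gt0 w; have aL := cL.1.
have e := @palindromic_coatoms w (Lw w \o tau r) (Lw w \o tau k) mw pal.
have {e} /(congr1 (fun F : int -> int => F r)) : Lw w \o tau r = Lw w \o tau k.
  apply: e => M [->|->].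
    by split; [exact: core_tau | apply: tau_fle => //; apply: ltW | exact: ell_tau_down].
  by split; [exact: core_tau | apply: tau_fle => //; apply: ltW | exact: ell_tau_down].
rewrite /= {1}/tau rfl_l.
case e: (eqm n r (k + 1)); last first.
  by rewrite /tau rflD //; [lia | rewrite eqm_sym].
move/eqmP: e => [t et]; rewrite et /tau rflR ?eqmS //.
by move: dr; rewrite et (aL (k + 1) t) (aL k t); lia.
Qed.

Definition ascending L r : Prop :=
  L (r + 1) < L r /\ forall k, eqm n k r = false -> L k <= L (k + 1).

Lemma ascending_mono L r (i j : nat) : ascending L r -> (i <= j)%N -> (j <= n)%N ->
  L (r + 1 + i%:Z) <= L (r + 1 + j%:Z).
Proof.
move=> [_ h]; elim: j => [|j IH]; first by case: i.
rewrite leq_eqVlt => /orP[/eqP -> //|ij] jn; apply: (le_trans (IH _ _)); try lia.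
have -> : r + 1 + j.+1%:Z = r + 1 + j%:Z + 1 by lia.
by apply: h; apply: eqm_neq; lia.
Qed.

(* The new core replaces the window entries x_i and x_j by x_j - 1 and x_i + 1. *)
Lemma second_coatom L r (i j : nat) : core n L -> ascending L r ->
    (i < j <= n)%N -> ~~ ((i == 0%N) && (j == n)) ->
    (forall l, (l < i)%N -> L (r + 1 + l%:Z) < L (r + 1 + i%:Z)) ->
    (forall l, (j < l <= n)%N -> L (r + 1 + j%:Z) < L (r + 1 + l%:Z)) ->
    L (r + 1 + i%:Z) + 2 <= L (r + 1 + j%:Z) ->
  exists M, [/\ core n M, fle n M L, (ell n M).+1 = ell n L & M <> L \o tau r].
Proof.
move=> cL asc /andP[ij jn] nij hi hj hij; have aL := cL.1.
pose p := r + 1; rewrite -/p in hi hj hij.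
(* One period back, x_j stands to the left of x_i and still has the larger level, so the exchange
   goes down. For i = 0 and j = n it would be [tau r] itself. *)
pose a := p + j%:Z + (- 1) * N; pose b := p + i%:Z.
have ab : a < b by rewrite /a /b; lia.
have La : L a = L (p + j%:Z) - 1 by rewrite /a aL.
have nab : eqm n a b = false by apply: eqm_neq; rewrite /a /b; lia.
exists (L \o rfl n a b); have aM : aff n (L \o rfl n a b) by apply: aff_rfl.
have Mi : (L \o rfl n a b) (p + i%:Z) = L (p + j%:Z) - 1 by rewrite /= -/b rfl_r.
have Mj : (L \o rfl n a b) (p + j%:Z) = L (p + i%:Z) + 1.
  have -> : p + j%:Z = a + 1 * N by rewrite /a; lia.
  by rewrite /= rflL aL.
have Ml (l : nat) : (l <= n)%N -> l != i -> l != j -> (L \o rfl n a b) (p + l%:Z) = L (p + l%:Z).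
  move=> ln li lj; rewrite /= rflD //; last by apply: eqm_neq; rewrite /b; lia.
  by rewrite /a eqm_sym eqm_shift; apply: eqm_neq; lia.
have W := @win_split n (L \o rfl n a b) p i j ij jn.
rewrite Mi Mj (@seg_eq (L \o rfl n a b) L) in W; last by move=> l hl; apply: Ml; lia.
rewrite (@seg_eq (L \o rfl n a b) L _ i.+1) in W; last by move=> l hl; apply: Ml; lia.
rewrite (@seg_eq (L \o rfl n a b) L _ j.+1) in W; last by move=> l hl; apply: Ml; lia.
have lM : (ell n (L \o rfl n a b)).+1 = ell n L.
  rewrite -(ell_win p aM) W -(ell_win p aL) (@win_split n L p i j ij jn).
  apply/esym; apply: ells_pair => // x /segP[l hl ->].
  - by apply: hi; lia.
  - by rewrite !ascending_mono //; lia.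
  - by apply: hj; lia.
split=> //.
- split=> //; have := aff_sum_win 1 p aM; rewrite W.
  have := sum_win p cL; rewrite (@win_split n L p i j ij jn).
  rewrite !big_cat /= !big_cons !big_cat /= !big_cons; lia.
- by apply: fle_rfl_down => //; rewrite La /b; lia.
(* At p the core [L \o tau r] has level x_n - 1. The new core has the smaller level x_j - 1 if i =
   0, and x_0 if i > 0. *)
move=> /(congr1 (fun F : int -> int => F p)).
have -> : (L \o tau r) p = L (p + n%:Z) - 1.
  rewrite /= /tau rfl_r ?eqmS //; have -> : r = p + n%:Z + (- 1) * N by rewrite /p; lia.
  by rewrite aL.
case: (posnP i) => [i0|i0].
  have := hj n; have -> : (L \o rfl n a b) p = L (p + j%:Z) - 1.
    by rewrite -Mi i0 addr0.
  by move=> h1 h2; have := h1; rewrite i0 /= in nij; lia.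
have := Ml 0%N; rewrite addr0 => ->; try lia.
have := ascending_mono asc (i := i) (j := n); have := hi 0%N; rewrite addr0.
have := ascending_mono asc (i := j) (j := n); rewrite -/p; lia.
Qed.

(** Write x and y for the two values. One step below L lies [M0], with window y - 1, then copies of
    x, then copies of y, then x + 1. Swapping its first two entries, its last two, or its two ends
    goes down once more; the first entry becomes x, stays y - 1, or becomes x + 1, and these differ
    because y >= x + 3. *)
Lemma three_cocoatoms L r (c : nat) : core n L -> (1 < c < n)%N ->
    (forall i, (i < c)%N -> L (r + 1 + i%:Z) = L (r + 1)) ->
    (forall i, (c <= i <= n)%N -> L (r + 1 + i%:Z) = L (r + 1 + n%:Z)) ->
    L (r + 1) + 3 <= L (r + 1 + n%:Z) ->
  exists M1 M2 M3, [/\ M1 <> M2, M1 <> M3, M2 <> M3 &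
    forall M, [\/ M = M1, M = M2 | M = M3] ->
     [/\ core n M, fle n M L & (ell n M).+2 = ell n L]].
Proof.
move=> cL /andP[c1 cn] hlo hhi h3; have aL := cL.1.
set x := L (r + 1) in hlo h3; set y := L (r + 1 + n%:Z) in hhi h3.
have Lr : L r = y - 1.
  by have -> : r = r + 1 + n%:Z + (- 1) * N; [lia | rewrite aL].
pose M0 := L \o tau r; have cM0 : core n M0 by exact: core_tau.
have aM0 := cM0.1.
have M0a : M0 (r + 1) = y - 1 by rewrite /M0 /= /tau rfl_r ?eqmS.
have M0n : M0 (r + 1 + n%:Z) = x + 1.
  have -> : r + 1 + n%:Z = r + 1 * N by lia.
  by rewrite /M0 /= /tau rflL aL.
have M0m (i : nat) : (0 < i < n)%N -> M0 (r + 1 + i%:Z) = L (r + 1 + i%:Z).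
  by move=> hi; rewrite /M0 /= /tau rflD //; apply: eqm_neq; lia.
have M01 : M0 (r + 1 + 1) = x by rewrite (M0m 1%N) ?hlo //; lia.
have M0y : M0 (r + n%:Z) = y.
  have -> : r + n%:Z = r + 1 + n.-1%:Z by lia.
  by rewrite M0m ?hhi //; lia.
have nends : eqm n (r + 1) (r + 1 + n%:Z) = false by apply: eqm_neq; lia.
pose M1 := M0 \o tau (r + 1); pose M2 := M0 \o tau (r + n%:Z).
pose M3 := M0 \o rfl n (r + 1) (r + 1 + n%:Z).
have f0 : fle n M0 L by apply: tau_fle => //; rewrite Lr -/x; lia.
have l0 : (ell n M0).+1 = ell n L by apply: ell_tau_down => //; rewrite Lr -/x; lia.
have rn1 : r + n%:Z + 1 = r + 1 + n%:Z by lia.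
have v1 : M1 (r + 1) = x by rewrite /M1 /= /tau rfl_l M01.
have v2 : M2 (r + 1) = y - 1.
  by rewrite /M2 /= /tau rflD ?M0a //; apply: eqm_neq; lia.
have v3 : M3 (r + 1) = x + 1 by rewrite /M3 /= rfl_l M0n.
have v3n : M3 (r + 1 + n%:Z) = y - 1 by rewrite /M3 /= rfl_r.
have d1 : M0 (r + 1 + 1) < M0 (r + 1) by rewrite M01 M0a; lia.
have d2 : M0 (r + n%:Z + 1) < M0 (r + n%:Z) by rewrite rn1 M0n M0y; lia.
have ne (F G : int -> int) : F (r + 1) != G (r + 1) -> F <> G.
  by move=> h e; rewrite e eqxx in h.
have W0 := @win_split n M0 (r + 1) 0 n n_gt0 (leqnn n).
have W3 := @win_split n M3 (r + 1) 0 n n_gt0 (leqnn n).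
have M3m : seg M3 (r + 1) 1 (n - 1) = seg M0 (r + 1) 1 (n - 1).
  by apply: seg_eq => l hl; rewrite /M3 /= rflD //; apply: eqm_neq; lia.
rewrite M3m v3n addr0 v3 /seg subnn /= -/(seg M0 _ _ _) in W3.
rewrite M0n addr0 M0a /seg subnn /= -/(seg M0 _ _ _) in W0.
have aM3 : aff n M3 by apply: aff_rfl.
exists M1, M2, M3; split; try by apply: ne; rewrite ?v1 ?v2 ?v3; lia.
move=> M [->|->|->].
- split; [exact: core_tau | | by rewrite ell_tau_down].
  by apply: fle_trans f0; apply: tau_fle => //; apply: ltW.
- split; [exact: core_tau | | by rewrite ell_tau_down].
  by apply: fle_trans f0; apply: tau_fle => //; apply: ltW.
split.
- split=> //; have := aff_sum_win 1 (r + 1) aM3; rewrite W3.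
  have := sum_win (r + 1) cM0; rewrite W0.
  by rewrite !big_cons !big_cat !big_seq1 /=; lia.
- by apply: fle_trans f0; apply: fle_rfl_down => //; [lia | rewrite M0n M0a; lia].
rewrite -l0 -(ell_win (r + 1) aM3) W3 -(ell_win (r + 1) aM0) W0 ells_swap_ends //.
move=> z /segP[l hl ->]; rewrite M0m; last by lia.
have [lc|lc] := ltnP l c; first by rewrite hlo // eqxx.
by rewrite hhi ?eqxx ?orbT //; lia.
Qed.

(** The window from b + 1 takes only the values v0 and v0 + 1, so the level at b is at most v0 and
    the one at b + 1 at least v0: there is no descent at b. Stripping any other descent permutes
    levels inside the window and keeps the hypothesis. *)
Lemma two_valued_avoid w b (v0 : int) : is_min_rep w ->
    (forall j, v0 <= Lw w j - ((j - (b + 1)) %/ N)%Z <= v0 + 1) ->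
  exists u : seq 'I_n.+1, affA_word u = w /\
    {in u, forall c : 'I_n.+1, eqm n (c : nat) b = false}.
Proof.
have [m] := ubnP (len w); elim: m w => // m IH w lem mw h.
case: (posnP (len w)) => [/len_eq0 ->|lw]; first by exists [::].
have [k [dk mw' lk]] := min_rep_step n_gt0 mw lw.
have nkb : eqm n k b = false.
  apply/negP => /eqmP[t et]; have := h k; have := h (k + 1); rewrite et.
  have -> : b + t * N + 1 - (b + 1) = t * N + 0 by lia.
  have -> : b + t * N - (b + 1) = (t - 1) * N + n%:Z by lia.
  by rewrite !divzMDl // div0z floor_small; [rewrite et in dk; lia | lia].
have [||u [eu hu]] := IH (sg k * w)%g _ mw'; first by lia.
  move=> j; have := h (tau k j); rewrite lev_sg // floor_tau //=.
  by have -> : b + 1 - 1 = b by lia.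
have [c [ec ekc]] := sg_ex n_gt0 k.
exists (c :: u); split.
  by rewrite word_cons // eu -sg_ord // -ec sgK.
move=> d; rewrite inE => /orP[/eqP ->|]; last exact: hu.
apply/negP => e; move/negP: nkb; apply; exact: eqm_trans ekc e.
Qed.

(** Suppose w ascends at k0, between x_i and x_(i + 1). Read from there, the window is x_(i + 1),
    ..., x_n, x_0 + 1, ..., x_i + 1, and all entries are x_0 + 1 or x_0 + 2. Hence some word for w
    avoids s_k0, which then is not below w. *)
Lemma gap2_cpo w r : is_min_rep w -> ascending (Lw w) r ->
  Lw w (r + 1 + n%:Z) <= Lw w (r + 1) + 2 -> is_cpo w.
Proof.
move=> mw asc gap k0; rewrite sg_nat => hk; apply/coset_leP => //; rewrite lev_sg //.
have aL := lev_aff n_gt0 1 w.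
have [h|h] := leP (Lw w (k0%:Z + 1)) (Lw w k0); first by apply: tau_fle.
exfalso; have [i [s e]] := window_ex n k0 (r + 1).
set X := fun l : nat => Lw w (r + 1 + l%:Z).
have mono (l l' : nat) : (l <= l')%N -> (l' <= n)%N -> X l <= X l' by exact: ascending_mono asc.
have gap' : X n <= X 0%N + 2 by rewrite /X addr0.
have hi := ltn_ord i.
have e1 : k0%:Z + 1 + s * N = r + 1 + i.+1%:Z by lia.
have hX : X i < X i.+1 by rewrite /X -e -e1 !aL; lia.
have iltn : (i < n)%N.
  case: (ltnP i n) => // ni; have [dr _] := asc.
  have ein : i = n :> nat by lia.
  move: hX; rewrite /X ein; have -> : r + 1 + n.+1%:Z = r + 1 + 1 * N by lia.
  have -> : r + 1 + n%:Z = r + 1 * N by lia.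
  by rewrite !aL; lia.
have [|u [eu hu]] := @two_valued_avoid w (k0%:Z + s * N) (X 0%N + 1) mw; last first.
  apply: (@avoid_bruhat n n_gt0 u k0); last by rewrite eu.
  by move=> c /hu; rewrite eqm_sym eqm_shift eqm_sym.
move=> j; have [l [t et]] := window_ex n j (k0%:Z + s * N + 1).
have -> : j = k0%:Z + s * N + 1 + l%:Z + (- t) * N by lia.
have -> : k0%:Z + s * N + 1 + l%:Z + (- t) * N - (k0%:Z + s * N + 1) = (- t) * N + l%:Z by lia.
have hl := ltn_ord l.
rewrite aL divzMDl // floor_small; last by lia.
rewrite e; have [ln|ln] := leqP (i.+1 + l) n.
  have -> : r + 1 + i%:Z + 1 + l%:Z = r + 1 + (i.+1 + l)%N%:Z by lia.
  rewrite -/(X (i.+1 + l)%N); have := mono i.+1 (i.+1 + l)%N; have := mono (i.+1 + l)%N n.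
  by have := mono 0%N i; lia.
have -> : r + 1 + i%:Z + 1 + l%:Z = r + 1 + (i.+1 + l - n.+1)%N%:Z + 1 * N by lia.
rewrite aL -/(X (i.+1 + l - n.+1)%N); have := mono 0%N (i.+1 + l - n.+1)%N.
by have := mono (i.+1 + l - n.+1)%N i; have := mono i.+1 n; lia.
Qed.

(* The cores with rows m n, ..., 2 n, n, and their transposes: these are the spiral
   elements of length m n. *)
Definition row_shape L (m : nat) : Prop :=
  forall i, (i <= n)%N -> L (1 - m%:Z + i%:Z) = if i == n then - m%:Z else 0.

Definition col_shape L (m : nat) : Prop :=
  forall i, (i <= n)%N -> L (1 + m%:Z + i%:Z) = if i == 0%N then m%:Z else 0.

Lemma sum_seg_const L p (i m : nat) (v : int) :
  (forall l, (i <= l < i + m)%N -> L (p + l%:Z) = v) -> \sum_(x <- seg L p i m) x = m%:Z * v.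
Proof.
move=> h; have -> : seg L p i m = nseq m v; last first.
  by elim: m {h} => [|m IH]; rewrite ?big_nil ?mul0r //= sum_cons IH; lia.
apply: (@eq_from_nth _ 0) => [|l]; rewrite size_map size_iota ?size_nseq // => hl.
by rewrite (nth_map 0%N) ?size_iota // nth_iota // nth_nseq hl h //; lia.
Qed.

Theorem palindromic_shape w : is_min_rep w -> palindromic w ->
  is_cpo w \/ exists2 m, (0 < m)%N & row_shape (Lw w) m \/ col_shape (Lw w) m.
Proof.
move=> mw pal; case: (posnP (len w)) => [/len_eq0 ->|lw].
  left=> k /(bruhat_len); rewrite len1 sg_nat leqn0 => /eqP /len_eq0 e.
  by have := odd_sg n_gt0 k; rewrite e len1.
have [r [dr _ _]] := min_rep_step n_gt0 mw lw.
have cL := core_Lw n_gt0 w; have aL := cL.1.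
have asc : ascending (Lw w) r.
  by split=> // k; apply: palindromic_desc.
have [gap|gap] := leP (Lw w (r + 1 + n%:Z)) (Lw w (r + 1) + 2).
  by left; apply: gap2_cpo gap.
right; set X := fun l : nat => Lw w (r + 1 + l%:Z).
have mono (l l' : nat) : (l <= l')%N -> (l' <= n)%N -> X l <= X l' by exact: ascending_mono asc.
have gap' : X 0%N + 2 < X n by rewrite /X addr0.
(* The entry at i0 is the first above x_0, and the one at j1 the first equal to x_n; i0 < j1 means
   that some entry lies strictly between. *)
have [|i0 [i0n hi0 hi1]] := @first_index (fun i => X 0%N < X i) n; first by lia.
have [|j1 [j1n /eqP hj1 hj2]] := @first_index (fun i => X i == X n) n; first exact: eqxx.
have [ij|ij] := ltnP i0 j1.
  exfalso; suff [M [cM fM lM nM]] : exists M,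
      [/\ core n M, fle n M (Lw w), (ell n M).+1 = ell n (Lw w) & M <> Lw w \o tau r].
    apply: nM; apply: palindromic_coatoms mw pal _ => M' [->//|->].
    by split; [exact: core_tau | apply: tau_fle => //; apply: ltW | exact: ell_tau_down].
  have hlast l : (j1.-1 < l <= n)%N -> X j1.-1 < X l.
    move=> hl; have := hj2 j1.-1; have := mono j1.-1 n; have := mono j1 l; lia.
  (* The last intermediate entry is paired with x_0 if it is at least x_0 + 2. Otherwise all
     intermediate entries equal x_0 + 1, and the first of them is far enough from x_n. *)
  have [gA|gB] := leP (X 0%N + 2) (X j1.-1).
    apply: (@second_coatom _ r 0%N j1.-1 cL asc) => //.
    - have : j1.-1 != 0%N by apply/eqP => e; rewrite e in gA; lia.
      by lia.
    - by lia.
  apply: (@second_coatom _ r i0 n cL asc) => //.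
  - by have := hlast n; have := mono i0 j1.-1; lia.
  - have : i0 != 0%N by apply/eqP => e; rewrite e ltxx in hi0.
    lia.
  - move=> l hl; have := hi1 l hl; rewrite -leNgt => h; exact: le_lt_trans h hi0.
  - by move=> l; lia.
  by have := mono i0 j1.-1; rewrite -/(X i0) -/(X n); lia.
have hlo i : (i < i0)%N -> X i = X 0%N.
  by move=> h; have := hi1 i h; have := mono 0%N i; lia.
have hhi i : (i0 <= i <= n)%N -> X i = X n.
  by move=> h; have := mono j1 i; have := mono i n; lia.
have i00 : (0 < i0)%N by case: (posnP i0) => // e; rewrite e ltxx in hi0.
have hXi i : (i <= n)%N -> Lw w (r + 1 + i%:Z) = if (i < i0)%N then X 0%N else X n.
  by move=> hi; case: ltnP => h; [rewrite -/(X i) hlo | rewrite -/(X i) hhi //; lia].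
(* The window now consists of i0 copies of x_0 followed by copies of x_n. A single x_0 gives the
   rows, a single x_n the columns. *)
have [c1|[cn|c2]] : i0 = 1%N \/ (i0 = n \/ (1 < i0 < n)%N) by lia.
- exists (absz (X n - X 0%N - 1)%R); first by lia.
  left; set m := absz _; have em : m%:Z = X n - X 0%N - 1 by lia.
  (* Charge zero determines r from the two values, and so places the window where [row_shape]
     expects it. *)
  have hS : r = X 0%N + n%:Z * X n.
    have := sum_win (r + 1) cL; rewrite win_cons sum_cons.
    have -> : wtl n (Lw w) (r + 1 + 1) = seg (Lw w) (r + 1) 1 n.
      rewrite /wtl /seg -(addn0 1%N) iotaDl -map_comp; apply: eq_map => l /=; congr (Lw w); lia.
    rewrite (@sum_seg_const _ _ _ _ (X n)); last by move=> l hl; rewrite -/(X l) hhi //; lia.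
    by rewrite /X addr0; lia.
  move=> i hi; have -> : 1 - m%:Z + i%:Z = r + 1 + i.+1%:Z + (- X n) * N by nia.
  rewrite aL; case: eqP => [->|ni].
    have -> : r + 1 + n.+1%:Z = r + 1 + 1 * N by lia.
    by have e0 : Lw w (r + 1) = X 0%N; [rewrite /X addr0 | rewrite aL e0; lia].
  by rewrite hXi; [case: ltnP; lia | lia].
- exists (absz (X n - X 0%N - 1)%R); first by lia.
  right; set m := absz _; have em : m%:Z = X n - X 0%N - 1 by lia.
  have hS : r = n%:Z * X 0%N + X n.
    have := sum_win (r + 1) cL; rewrite win_rcons // sum_rcons.
    have -> : wtl n (Lw w) (r + 1) = seg (Lw w) (r + 1) 0 n by [].
    rewrite (@sum_seg_const _ _ _ _ (X 0%N)); last by move=> l hl; rewrite -/(X l) hlo //; lia.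
    have -> : Lw w r = X n - 1 by rewrite /X -[RHS](aL _ (- 1)); congr (Lw w); lia.
    by lia.
  move=> i hi; have -> : 1 + m%:Z + i%:Z = r + i%:Z + (- X 0%N) * N by nia.
  rewrite aL; case: (posnP i) => [->|i1].
    have -> : r + 0%:Z = r + 1 + n%:Z + (- 1) * N by lia.
    by rewrite aL -/(X n); lia.
  have -> : r + i%:Z = r + 1 + i.-1%:Z by lia.
  by rewrite hXi; [case: ltnP; lia | lia].
have e0 : Lw w (r + 1) = X 0%N by rewrite /X addr0.
exfalso; have [|||M1 [M2 [M3 [h12 h13 h23 h]]]] := @three_cocoatoms (Lw w) r i0 cL c2.
- by move=> i /hlo; rewrite e0.
- exact: hhi.
- by rewrite e0 -/(X n); lia.
by case: (palindromic_cocoatoms mw pal h).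
Qed.

End Obstruction.

(** * Spiral elements *)

Section Gauss.

(* Compositions of m into k parts.  Either the last part is 0, or rotating the
   window backwards lowers the sum by one without changing [ells]. *)
Fixpoint comps (k m : nat) {struct k} : seq (seq int) :=
  match k with
  | 0 => if m is 0 then [:: [::]] else [::]
  | k'.+1 => (fix comps_k (m : nat) : seq (seq int) :=
      match m with
      | 0 => [:: nseq k 0]
      | m'.+1 => [seq rcons c 0 | c <- comps k' m] ++
          [seq rcons (behead c) (head 0 c + 1) | c <- comps_k m']
      end) m
  end.

Lemma compsSS k m : comps k.+1 m.+1 = [seq rcons c 0 | c <- comps k m.+1] ++
  [seq rcons (behead c) (head 0 c + 1) | c <- comps k.+1 m].
Proof. by []. Qed.

Lemma compsP k m (c : seq int) : reflect
  [/\ size c = k, {in c, forall x, 0 <= x} & \sum_(x <- c) x = m%:Z] (c \in comps k m).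
Proof.
elim: k m c => [|k IHk] m c.
  case: m => [|m]; rewrite ?inE; apply: (iffP idP).
  - by move=> /eqP ->; rewrite big_nil.
  - by case=> /eqP; rewrite size_eq0.
  - by [].
  - by case=> /eqP; rewrite size_eq0 => /eqP -> _; rewrite big_nil.
elim: m c => [|m IHm] c.
  rewrite inE; apply: (iffP eqP) => [->|[sc pc e]].
    split; first by rewrite size_nseq.
      by move=> x /nseqP[->].
    by rewrite big1_seq // => x /andP[_ /nseqP[->]].
  apply: (@eq_from_nth _ 0) => [|i]; rewrite sc ?size_nseq // => hi.
  by rewrite nth_nseq hi; apply: (sum_eq0 pc e); rewrite mem_nth ?sc.
rewrite compsSS mem_cat; apply: (iffP orP).
  case=> /mapP[d].
    move=> /IHk[sd pd e] ->; rewrite size_rcons sd sum_rcons e addr0; split=> // x.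
    by rewrite mem_rcons inE => /orP[/eqP ->//|/pd].
  move=> /IHm[]; case: d => [|y d] //= sd pd e ->.
  rewrite size_rcons sd sum_rcons; split=> //.
    have := pd y (mem_head y d) => y0 x; rewrite mem_rcons inE => /orP[/eqP ->|xd]; first by lia.
    by apply: pd; rewrite inE xd orbT.
  by move: e; rewrite sum_cons; lia.
move=> [sc pc e]; case/lastP: c sc pc e => [|c y]; first by [].
rewrite size_rcons sum_rcons => -[sc] pc e.
have y0 : 0 <= y by apply: pc; rewrite mem_rcons mem_head.
have pc' : {in c, forall x, 0 <= x} by move=> x xc; apply: pc; rewrite mem_rcons inE xc orbT.
have [e0|y1] : y = 0 \/ 0 < y by lia.
  left; apply/mapP; exists c; last by rewrite e0.
  by apply/IHk; split=> //; rewrite e0 addr0 in e.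
right; apply/mapP; exists ((y - 1) :: c) => /=; last by rewrite subrK.
apply/IHm; split=> /=; [by rewrite sc | | by rewrite sum_cons; lia].
by move=> x; rewrite inE => /orP[/eqP ->|/pc' //]; lia.
Qed.

Arguments comps : simpl never.

Lemma comps_uniq k m : uniq (comps k m).
Proof.
elim: k m => [|k IHk] m; first by case: m.
elim: m => [//|m IHm]; rewrite compsSS cat_uniq.
rewrite map_inj_uniq ?IHk => [|c c' /rcons_inj[]] //=.
apply/andP; split.
  apply/hasPn => c /mapP[d hd ->]; apply/negP => /mapP[d' _ /rcons_inj[_ h]].
  move/compsP: hd => [sd pd _]; case: d sd pd h => //= y d _ /(_ y (mem_head y d)); lia.
rewrite map_inj_in_uniq // => c c' /compsP[sc _ _] /compsP[sc' _ _] /rcons_inj[].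
by case: c sc => // x c _; case: c' sc' => // x' c' _ /= -> /addIr ->.
Qed.

(** For k > 0, the Gaussian binomial coefficient of k + m - 1 over m. *)
Definition gpoly (k m : nat) : {poly int} := \sum_(c <- comps k m) 'X^(ells c).

(** A final 0 adds [phi x 0], which is x, for every part x, hence m + 1 in total; rotation leaves
    [ells] alone. *)
Lemma gpolySS k m : gpoly k.+1 m.+1 = gpoly k.+1 m + 'X^(m.+1) * gpoly k m.+1.
Proof.
rewrite /gpoly compsSS big_cat /= addrC !big_map mulr_sumr; congr (_ + _).
  apply: eq_big_seq => c /compsP[sc _ _]; case: c sc => // x c _ /=.
  by rewrite -ells_rot.
apply: eq_big_seq => c /compsP[sc pc e]; rewrite -exprD ells_rcons addnC; congr ('X^(_ + _)).
have : (\sum_(x <- c) phi x 0)%N%:Z = m.+1%:Z; last by case.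
rewrite -e (big_morph Posz PoszD (erefl _)); apply: eq_big_seq => x /pc.
by rewrite /phi; case: ifP; lia.
Qed.

Lemma gpoly_m0 k : gpoly k 0 = 1.
Proof. 
case: k => [|k]; rewrite /gpoly ?big_seq1 //.
by rewrite ells_nseq.
 Qed.

Lemma gpoly0 m : gpoly 0 m.+1 = 0.
Proof. by rewrite /gpoly big_nil. Qed.

Lemma gpoly1 m : gpoly 1 m = 1.
Proof. by elim: m => [|m IH]; rewrite ?gpoly_m0 // gpolySS IH gpoly0 mulr0 addr0. Qed.

(** The other Pascal recursion. It has no direct reading on [comps] and is obtained from [gpolySS]
    by a double induction. *)
Lemma gpolySS' k m : gpoly k.+2 m.+1 = gpoly k.+1 m.+1 + 'X^(k.+1) * gpoly k.+2 m.
Proof.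
elim: k m => [|k IHk]; elim=> [|m IHm].
- by rewrite gpolySS !gpoly1 !gpoly_m0.
- rewrite gpolySS {1}IHm (gpolySS 1 m) !gpoly1 !exprS !expr0; ring.
- have e1 := gpolySS k.+1 0; have e2 := IHk 0%N; rewrite gpoly_m0 in e1 e2.
  rewrite gpolySS gpoly_m0 {1}e2 e1 !exprS !expr0; ring.
- rewrite gpolySS [in LHS]IHm [in LHS](IHk m.+1) [in RHS](gpolySS k.+2 m).
  rewrite [in RHS](gpolySS k.+1 m.+1) !exprS; ring.
Qed.

Lemma gpoly_deg k m i : (k * m < i)%N -> (gpoly k.+1 m)`_i = 0.
Proof.
elim: k m i => [|k IHk] m i.
  by rewrite gpoly1 coef1; case: i.
elim: m i => [|m IHm] i; first by rewrite gpoly_m0 coef1 muln0; case: i.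
move=> h; rewrite gpolySS coefD coefXnM IHm; last by nia.
by rewrite add0r; case: ifP => // h'; apply: IHk; nia.
Qed.

(** Expanding one side by [gpolySS] and the other by [gpolySS'], the terms match crosswise. The
    degree bound covers the coefficients cut off by the power of X. *)
Lemma gpoly_sym k m i j : (i + j = k * m)%N -> (gpoly k.+1 m)`_i = (gpoly k.+1 m)`_j.
Proof.
elim: k m i j => [|k IHk] m i j.
  by rewrite mul0n; case: i j => [|i] [|j].
elim: m i j => [|m IHm] i j; first by rewrite muln0; case: i j => [|i] [|j].
move=> h; rewrite {1}gpolySS gpolySS' !coefD !coefXnM addrC; congr (_ + _).
  case: ltnP => hi; first by rewrite gpoly_deg //; nia.
  by apply: IHk; nia.
case: ltnP => hj; first by rewrite gpoly_deg //; nia.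
by apply: IHm; nia.
Qed.

Lemma coef_gpoly k m i : (gpoly k m)`_i = (count (fun c => ells c == i) (comps k m))%:Z.
Proof.
rewrite /gpoly coef_sum -sum1_count (big_morph Posz PoszD (erefl _)) [RHS]big_mkcond /=.
by apply: eq_bigr => c _; rewrite coefXn eq_sym; case: eqP.
Qed.

Lemma comps_sym k m i j : (i + j = k * m)%N ->
  count (fun c => ells c == i) (comps k.+1 m) = count (fun c => ells c == j) (comps k.+1 m).
Proof. by move=> /(@gpoly_sym k m); rewrite !coef_gpoly => -[]. Qed.

Lemma phi0 (m : nat) : phi m%:Z 0 = m.
Proof. by rewrite /phi subr0; case: ltP => //; lia. Qed.

(** Transposition of cores, seen on a window. *)
Definition revopp (s : seq int) : seq int := rev [seq - x | x <- s].

Lemma revoppK : involutive revopp.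
Proof.
by move=> s; rewrite /revopp map_rev revK -map_comp map_id_in // => x _ /=; rewrite opprK.
Qed.

Lemma ells_revopp s : ells (revopp s) = ells s.
Proof.
elim: s => // x s IH; rewrite /revopp /= rev_cons ells_rcons -/(revopp s) IH addnC.
congr addn; rewrite /revopp (perm_big [seq - y | y <- s]) ?perm_rev //= big_map; apply: eq_bigr => y _.
by rewrite /phi; do 2!case: ifP; lia.
Qed.

(** Here [negp (q - x)] is the positive part of x - q, which is superadditive on nonnegative x. *)
Lemma sum_negp_shift (s : seq int) (q : nat) : {in s, forall x, 0 <= x} ->
  (\sum_(x <- s) negp (q%:Z - x)%R <= negp (q%:Z - \sum_(x <- s) x)%R)%N.
Proof.
elim: s => [|x s IH] h; first by rewrite !big_nil.
have hs : {in s, forall y, 0 <= y} by move=> y ys; apply: h; rewrite inE ys orbT.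
have := IH hs; rewrite big_cons sum_cons; have := h x (mem_head x s).
have : 0 <= \sum_(y <- s) y by rewrite big_seq; apply: sumr_ge0 => y /hs.
move: (\sum_(y <- s) y) (\sum_(y <- s) _)%N => S T.
by rewrite /negp; do 3!case: ifP; lia.
Qed.

Lemma sum0_negp (s : seq int) (F : int -> int) : (\sum_(x <- s) negp (F x))%N = 0%N ->
  {in s, forall x, 0 <= F x}.
Proof.
move=> /eqP; rewrite sum_nat_seq_eq0 => /allP h x /h /=.
by rewrite /negp; case: ltP; lia.
Qed.

End Gauss.

(** * Intervals below the spiral cores, and words for these cores *)

Section Spiral.
Variable n : nat.
Hypothesis n_gt0 : (0 < n)%N.
Local Notation N := (n.+1%:Z).
Local Notation tau := (tau n).
Local Notation sg := (sg n).
Local Notation len := (@affA_length n).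
Local Notation Lw := (lev 1).
Implicit Types (L M : int -> int) (w v : affA n) (j p : int).

Definition Lof p (c : seq int) j : int :=
  nth 0 c (absz ((j - p) %% N)%Z) + ((j - p) %/ N)%Z.

Lemma Lof_aff p c : aff n (Lof p c).
Proof.
move=> j t; rewrite /Lof; have -> : j + t * N - p = t * N + (j - p) by lia.
by rewrite modzMDl divzMDl //; lia.
Qed.

Lemma Lof_at p c (i : nat) : (i <= n)%N -> Lof p c (p + i%:Z) = nth 0 c i.
Proof.
move=> hi; rewrite /Lof; have -> : p + i%:Z - p = i%:Z by lia.
by rewrite modz_small ?floor_small ?addr0 //; lia.
Qed.

Lemma win_Lof p c : size c = n.+1 -> win n (Lof p c) p = c.
Proof.
move=> sc; apply: (@eq_from_nth _ 0) => [|i]; rewrite size_win ?sc // => hi.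
by rewrite nth_win // Lof_at.
Qed.

Lemma win_inj p L M : aff n L -> aff n M -> win n L p = win n M p -> L = M.
Proof.
move=> aL aM e; apply: (aff_eq_win (j := p) aL aM) => i hi.
by rewrite -(@nth_win n L p i hi) -(@nth_win n M p i hi) e.
Qed.

Lemma core_Lof p c : size c = n.+1 -> \sum_(x <- c) x = p - 1 -> core n (Lof p c).
Proof.
move=> sc e; have aL := Lof_aff p c; split=> //.
by have := aff_sum_win 1 p aL; rewrite win_Lof // e; lia.
Qed.

(** Reading the window at p identifies the minimal representatives below w with the members of [cs],
    lengths becoming [ells]. *)
Lemma pcount_list w p (cs : seq (seq int)) i : is_min_rep w -> uniq cs ->
    (forall c, c \in cs -> size c = n.+1 /\ \sum_(x <- c) x = p - 1) ->
    (forall M, core n M -> fle n M (Lw w) <-> win n M p \in cs) ->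
  pcount w i = count (fun c => ells c == i) cs.
Proof.
move=> mw ucs hcs hM.
have [c|vf hvf] := boolp.choice
    (P := fun (c : seq int) (v : affA n) => c \in cs -> is_min_rep v /\ Lw v = Lof p c).
  have [hc|hc] := boolP (c \in cs); last by exists 1%g.
  have [sc ec] := hcs c hc.
  by have [v [h1 h2]] := min_rep_ex n_gt0 (core_Lof sc ec); exists v.
have lvf c : c \in cs -> len (vf c) = ells c.
  move=> hc; have [m e] := hvf c hc; have [sc _] := hcs c hc.
  rewrite (min_repP n_gt0 _).1 // e -(ell_win p (Lof_aff p c)) win_Lof //.
rewrite -size_filter -(size_map vf); apply/eqP; rewrite eqn_leq; apply/andP; split.
  apply: pcount_le => v mv vw lv.
  have cv := core_Lw n_gt0 v.
  have hc : win n (Lw v) p \in cs by apply/hM => //; apply: bruhat_fle.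
  apply/mapP; exists (win n (Lw v) p).
    by rewrite mem_filter hc andbT (ell_win p cv.1) -(min_repP n_gt0 _).1 // lv.
  have [m e] := hvf _ hc; apply: min_rep_uniq => //; rewrite e.
  by apply: (@win_inj p) => //; [exact: cv.1 | exact: Lof_aff | rewrite win_Lof ?size_win].
apply: pcount_ge.
  rewrite map_inj_in_uniq ?filter_uniq // => c c'; rewrite !mem_filter.
  move=> /andP[_ hc] /andP[_ hc'] e; have [_ e1] := hvf c hc; have [_ e2] := hvf c' hc'.
  rewrite -(win_Lof p (hcs c hc).1) -(win_Lof p (hcs c' hc').1) -e1 -e2 e //.
move=> v /mapP[c]; rewrite mem_filter => /andP[/eqP ec hc] ->; have [m e] := hvf c hc.
split=> //; last by rewrite lvf.
apply: fle_bruhat => //; rewrite e; apply/hM; last by rewrite win_Lof ?(hcs c hc).1.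
by apply: core_Lof; have [] := hcs c hc.
Qed.

Lemma beads_anti M j (d : nat) : aff n M -> (beads n M (j + d%:Z)%R <= beads n M j)%N.
Proof.
move=> aM; elim: d => [|d IH]; first by rewrite addr0.
apply: leq_trans IH; have := beadsS (j + d%:Z) aM.
by have -> : j + d%:Z + 1 = j + d.+1%:Z; lia.
Qed.

Definition gaps M j : nat := (\sum_(x <- win n M j) negp (- x)%R)%N.

Lemma gaps_mono M j (d : nat) : core n M -> (gaps M j <= gaps M (j + d%:Z)%R)%N.
Proof.
move=> cM; elim: d => [|d IH]; first by rewrite addr0.
apply: leq_trans IH _; have := beadsS (j + d%:Z) cM.1.
have := beads_gaps (j + d%:Z) cM; have := beads_gaps (j + d%:Z + 1) cM.
have -> : j + d%:Z + 1 = j + d.+1%:Z by lia.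
by rewrite -!/(gaps _ _); case: ltP; lia.
Qed.

Lemma win_term (F : int -> nat) M j (i : nat) : (i <= n)%N ->
  (F (M (j + i%:Z)%R) <= \sum_(x <- win n M j) F x)%N.
Proof.
move=> hi; have hm : M (j + i%:Z) \in win n M j by apply/mem_win; exists i.
by rewrite (big_rem _ hm) leq_addr.
Qed.

Lemma win_shift M j t : aff n M -> win n M (j + t * N) = [seq x + t | x <- win n M j].
Proof.
move=> aM; rewrite /win -map_comp; apply: eq_map => i /=.
by rewrite -aM; congr M; lia.
Qed.

(** Having no bead from 1 + m on suffices because, further left, gaps can be compared instead of
    beads: superadditivity bounds the gaps of M by those of the single nonzero class of L. *)
Lemma fle_col L M (m : nat) : core n L -> core n M -> col_shape n L m ->
  fle n M L <-> {in win n M (1 + m%:Z), forall x, 0 <= x}.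
Proof.
move=> cL cM sh; split=> [/(_ (1 + m%:Z))|pos j].
  rewrite {2}/beads big1_seq => [|x /andP[_ /mem_win[i hi ->]]]; last first.
    by rewrite sh //; case: ifP.
  by rewrite leqn0 => /eqP; apply: (@sum0_negp _ id).
have S := sum_win (1 + m%:Z) cM; rewrite addrAC subrr add0r in S.
have [hj|hj] := lerP (1 + m%:Z) j.
  have -> : j = 1 + m%:Z + (absz (j - (1 + m%:Z))%R)%:Z by lia.
  apply: leq_trans (beads_anti _ _ cM.1) _.
  by rewrite /beads big1_seq // => x /andP[_ /pos]; rewrite /negp; case: ltP; lia.
have := beads_gaps j cL; have := beads_gaps j cM; rewrite -!/(gaps _ _).
suff : (gaps M j <= gaps L j)%N by lia.
have [i [s e]] := window_ex n (1 + m%:Z) j; have hi := ltn_ord i.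
have s0 : s <= 0 by nia.
pose q := absz s; have eq : s = - q%:Z by lia.
(* The middle term is the number of gaps to the left of j in the class of 1 + m, for L. *)
apply: (@leq_trans (negp (q%:Z - m%:Z))).
  have -> : j = 1 + m%:Z + (- q%:Z) * N - i%:Z by lia.
  apply: leq_trans (gaps_mono _ i cM) _; rewrite subrK /gaps (win_shift _ _ cM.1) big_map.
  rewrite -{2}S; apply: leq_trans (sum_negp_shift q pos).
  by rewrite leq_eqVlt; apply/orP; left; apply/eqP/eq_bigr => x _; congr negp; lia.
have := @win_term (fun x => negp (- x)) L j i hi; rewrite -e cL.1.
have := sh 0%N (leq0n n); rewrite addr0 eqxx => ->.
by rewrite eq; have -> : - (m%:Z + - q%:Z) = q%:Z - m%:Z by lia.
Qed.

Lemma fle_row L M (m : nat) : core n L -> core n M -> row_shape n L m ->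
  fle n M L <-> {in win n M (1 - m%:Z), forall x, x <= 0}.
Proof.
move=> cL cM sh; split=> [/(_ (1 - m%:Z))|neg j].
  have := beads_gaps (1 - m%:Z) cL; have := beads_gaps (1 - m%:Z) cM.
  have -> : (\sum_(x <- win n L (1 - m%:Z)) negp (- x))%N = 0%N.
    rewrite big1_seq // => x /andP[_ /mem_win[i hi ->]].
    by rewrite sh // /negp; case: ifP; case: ifP; lia.
  move=> e1 e2 le; have /(@sum0_negp _ -%R) h : (\sum_(x <- win n M (1 - m%:Z)) negp (- x))%N = 0%N by lia.
  by move=> x /h; lia.
have S := sum_win (1 - m%:Z) cM; rewrite addrAC subrr add0r in S.
have [hj|hj] := lerP j (1 - m%:Z).
  have := beads_gaps j cL; have := beads_gaps j cM; rewrite -!/(gaps _ _).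
  suff : gaps M j = 0%N by lia.
  apply/eqP; rewrite -leqn0; have := gaps_mono j (absz (1 - m%:Z - j)%R) cM.
  have -> : j + (absz (1 - m%:Z - j)%R)%:Z = 1 - m%:Z by lia.
  rewrite /gaps [X in (_ <= X)%N]big1_seq // => x /andP[_ /neg].
  by rewrite /negp; case: ifP; lia.
have [i [s e]] := window_ex n (1 - m%:Z + n%:Z) j; have hi := ltn_ord i.
have s0 : 0 <= s by nia.
pose q := absz s; have eq : s = q%:Z by lia.
apply: (@leq_trans (negp (q%:Z - m%:Z))).
  have -> : j = 1 - m%:Z + q%:Z * N + (n - i)%N%:Z by lia.
  apply: leq_trans (beads_anti _ _ cM.1) _; rewrite /beads (win_shift _ _ cM.1) big_map.
  have pos : {in [seq - x | x <- win n M (1 - m%:Z)], forall x, 0 <= x}.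
    by move=> x /mapP[y /neg h ->]; lia.
  have S' : \sum_(x <- [seq - x | x <- win n M (1 - m%:Z)]) x = m%:Z.
    transitivity (- \sum_(x <- win n M (1 - m%:Z)) x); last by rewrite S opprK.
    by rewrite big_map sumrN.
  have := sum_negp_shift q pos; rewrite S' big_map.
  apply: leq_trans; rewrite leq_eqVlt; apply/orP; left; apply/eqP/eq_bigr => x _.
  by congr negp; lia.
have := @win_term negp L j i hi; rewrite -e cL.1 sh // eqxx.
by rewrite eq; have -> : - m%:Z + q%:Z = q%:Z - m%:Z by lia.
Qed.

Lemma win_col L m : col_shape n L m -> win n L (1 + m%:Z) = m%:Z :: nseq n 0.
Proof.
move=> sh; apply: (@eq_from_nth _ 0) => [|i]; rewrite size_win /= ?size_nseq // => hi.
by rewrite nth_win // sh //; case: i hi => //= i hi; rewrite nth_nseq; case: ifP.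
Qed.

Lemma win_row L m : row_shape n L m -> win n L (1 - m%:Z) = revopp (m%:Z :: nseq n 0).
Proof.
move=> sh; rewrite /revopp /= map_nseq oppr0 rev_cons rev_nseq.
apply: (@eq_from_nth _ 0) => [|i]; rewrite size_win ?size_rcons ?size_nseq // => hi.
rewrite nth_win // sh // nth_rcons size_nseq nth_nseq.
case: eqP => [->|ne]; first by rewrite ltnn.
by have -> : (i < n)%N by lia.
Qed.

Lemma ells_hook (m : nat) : ells (m%:Z :: nseq n 0) = (n * m)%N.
Proof.
rewrite /= ells_nseq addn0 big_nseq; rewrite phi0.
by elim: (n) => //= k ->; lia.
Qed.

Lemma ell_col L m : aff n L -> col_shape n L m -> ell n L = (n * m)%N.
Proof. by move=> aL sh; rewrite -(ell_win (1 + m%:Z) aL) win_col // ells_hook. Qed.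

Lemma ell_row L m : aff n L -> row_shape n L m -> ell n L = (n * m)%N.
Proof. by move=> aL sh; rewrite -(ell_win (1 - m%:Z) aL) win_row // ells_revopp ells_hook. Qed.

Lemma palindromic_col w m : is_min_rep w -> col_shape n (Lw w) m -> palindromic w.
Proof.
move=> mw sh; have cL := core_Lw n_gt0 w; apply/palindromicP => i.
rewrite (min_repP n_gt0 w).1 // (ell_col cL.1 sh) => hi.
have E k : pcount w k = count (fun c => ells c == k) (comps n.+1 m).
  apply: (@pcount_list w (1 + m%:Z)) => // [|c /compsP[h1 _ h2]|M cM].
  - exact: comps_uniq.
  - by rewrite h2; split=> //; lia.
  rewrite (fle_col cL cM sh); split=> [h|/compsP[]//].
  by apply/compsP; rewrite size_win; split=> //; rewrite sum_win //; lia.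
by rewrite !E; apply: comps_sym; lia.
Qed.

Lemma palindromic_row w m : is_min_rep w -> row_shape n (Lw w) m -> palindromic w.
Proof.
move=> mw sh; have cL := core_Lw n_gt0 w; apply/palindromicP => i.
rewrite (min_repP n_gt0 w).1 // (ell_row cL.1 sh) => hi.
have Srev (c : seq int) : \sum_(x <- revopp c) x = - \sum_(x <- c) x.
  by rewrite /revopp (perm_big [seq - y | y <- c]) ?perm_rev //= big_map sumrN.
have E k : pcount w k = count (fun c => ells c == k) (comps n.+1 m).
  transitivity (count (fun c => ells c == k) (map revopp (comps n.+1 m))); last first.
    by rewrite count_map; apply: eq_count => c /=; rewrite ells_revopp.
  apply: (@pcount_list w (1 - m%:Z)) => // [|c /mapP[d /compsP[h1 _ h2] ->]|M cM].
  - by rewrite (map_inj_uniq (inv_inj revoppK)) comps_uniq.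
  - by rewrite size_rev size_map Srev h2; split=> //; lia.
  rewrite (fle_row cL cM sh) -{2}(revoppK (win n M (1 - m%:Z))) (mem_map (inv_inj revoppK)).
  split=> [h|/compsP[_ h _] x hx]; last first.
    have : - x \in revopp (win n M (1 - m%:Z)) by rewrite mem_rev map_f.
    by move=> /h; lia.
  apply/compsP; rewrite size_rev size_map size_win Srev sum_win //; split=> //; last by lia.
  by move=> x; rewrite mem_rev => /mapP[y /h hy ->]; lia.
by rewrite !E; apply: comps_sym; lia.
Qed.

(** Products of l consecutive generators ending in s_0, with indices running through negative or
    through positive integers. The spiral elements are those with l a positive multiple of n. *)
Fixpoint colw (l : nat) : affA n := if l is l'.+1 then (sg (- l'%:Z) * colw l')%g else 1%g.
Fixpoint roww (l : nat) : affA n := if l is l'.+1 then (sg l'%:Z * roww l')%g else 1%g.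

Lemma len_colw l : (len (colw l) <= l)%N.
Proof. by elim: l => [|l IH] /=; [rewrite len1 | apply: leq_trans (len_sg_le n_gt0 _ _) _]. Qed.

Lemma len_roww l : (len (roww l) <= l)%N.
Proof. by elim: l => [|l IH] /=; [rewrite len1 | apply: leq_trans (len_sg_le n_gt0 _ _) _]. Qed.

Lemma base_window (i : nat) : (i <= n)%N -> base n (1 + i%:Z) = 0.
Proof. by move=> hi; rewrite /base floor_small //; lia. Qed.

Lemma colw_shape m : col_shape n (Lw (colw (m * n))) m.
Proof.
elim: m => [|m IH].
  by move=> i hi; rewrite mul0n /= Lw1 // addr0 base_window //; case: ifP.
have aL0 := lev_aff n_gt0 1 (colw (m * n)).
(* Each further letter moves the entry m one place to the left in the window ending at m + 1; after
   n letters it is first, and a shift by one period gives the next shape. *)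
have H i : (i <= n)%N -> forall t : nat, (t <= n)%N ->
    Lw (colw (m * n + i)) (m%:Z + 1 - n%:Z + t%:Z) = if t == (n - i)%N then m%:Z else - 1.
  elim: i => [|i IHi] hi t ht.
    rewrite addn0 subn0; case: eqP => [->|nt].
      have -> : m%:Z + 1 - n%:Z + n%:Z = 1 + m%:Z + 0%:Z by lia.
      by rewrite IH.
    have -> : m%:Z + 1 - n%:Z + t%:Z = 1 + m%:Z + t.+1%:Z + (- 1) * N by lia.
    by rewrite aL0 IH //; lia.
  rewrite addnS /= lev_sg // -(tau_shift n m%:Z (- _)).
  have -> : - (m * n + i)%N%:Z + m%:Z * N = m%:Z - i%:Z by lia.
  rewrite /= /tau.
  have [e1|[e2|[e3 e4]]] : t = (n - i.+1)%N \/ (t = (n - i)%N \/ (t <> (n - i.+1)%N /\ t <> (n - i)%N)) by lia.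
  - have -> : m%:Z + 1 - n%:Z + t%:Z = m%:Z - i%:Z by lia.
    rewrite rfl_l; have -> : m%:Z - i%:Z + 1 = m%:Z + 1 - n%:Z + (n - i)%N%:Z by lia.
    by rewrite IHi ?eqxx; [rewrite e1 eqxx | lia | lia].
  - have -> : m%:Z + 1 - n%:Z + t%:Z = m%:Z - i%:Z + 1 by lia.
    rewrite rfl_r ?eqmS //; have -> : m%:Z - i%:Z = m%:Z + 1 - n%:Z + (n - i.+1)%N%:Z by lia.
    by rewrite IHi; [do 2!case: eqP; lia | lia | lia].
  rewrite rflD; try by apply: eqm_neq; lia.
  by rewrite IHi; [do 2!case: eqP; lia | lia | lia].
move=> i hi; have -> : 1 + m.+1%:Z + i%:Z = m%:Z + 1 - n%:Z + i%:Z + 1 * N by lia.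
rewrite mulSn addnC (lev_aff n_gt0) H // subnn.
by case: eqP; lia.
Qed.

Lemma roww_shape m : row_shape n (Lw (roww (m * n))) m.
Proof.
elim: m => [|m IH].
  by move=> i hi; rewrite mul0n /= Lw1 // subr0 base_window //; case: ifP.
have aL0 := lev_aff n_gt0 1 (roww (m * n)).
(* Mirror image: the entry - (m + 1) travels to the right. *)
have H i : (i <= n)%N -> forall t : nat, (t <= n)%N ->
    Lw (roww (m * n + i)) (- m%:Z + t%:Z) = if t == i then - m.+1%:Z else 0.
  elim: i => [|i IHi] hi t ht.
    rewrite addn0; case: eqP => [->|nt].
      have -> : - m%:Z + 0%:Z = 1 - m%:Z + n%:Z + (- 1) * N by lia.
      by rewrite aL0 IH // eqxx; lia.
    have -> : - m%:Z + t%:Z = 1 - m%:Z + t.-1%:Z by lia.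
    by rewrite IH; [case: eqP; lia | lia].
  rewrite addnS /= lev_sg // -(tau_shift n (- m%:Z)).
  have -> : (m * n + i)%N%:Z + - m%:Z * N = - m%:Z + i%:Z by lia.
  rewrite /= /tau.
  have [e1|[e2|[e3 e4]]] : t = i.+1 \/ (t = i \/ (t <> i.+1 /\ t <> i)) by lia.
  - have -> : - m%:Z + t%:Z = - m%:Z + i%:Z + 1 by lia.
    by rewrite rfl_r ?eqmS // IHi ?eqxx; [rewrite e1 eqxx | lia | lia].
  - have -> : - m%:Z + t%:Z = - m%:Z + i%:Z by lia.
    rewrite rfl_l; have -> : - m%:Z + i%:Z + 1 = - m%:Z + i.+1%:Z by lia.
    by rewrite IHi; [do 2!case: eqP; lia | lia | lia].
  rewrite rflD; try by apply: eqm_neq; lia.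
  by rewrite IHi; [do 2!case: eqP; lia | lia | lia].
move=> i hi; have -> : 1 - m.+1%:Z + i%:Z = - m%:Z + i%:Z by lia.
by rewrite mulSn addnC H.
Qed.

Lemma colw_min m : is_min_rep (colw (m * n)).
Proof.
apply/(min_repP n_gt0)/eqP; rewrite eqn_leq ell_len // andbT.
by rewrite (ell_col (lev_aff n_gt0 _ _) (colw_shape m)) mulnC len_colw.
Qed.

Lemma roww_min m : is_min_rep (roww (m * n)).
Proof.
apply/(min_repP n_gt0)/eqP; rewrite eqn_leq ell_len // andbT.
by rewrite (ell_row (lev_aff n_gt0 _ _) (roww_shape m)) mulnC len_roww.
Qed.

Lemma colw_uniq w m : is_min_rep w -> col_shape n (Lw w) m -> w = colw (m * n).
Proof.
move=> mw sh; apply: min_rep_uniq => //; first exact: colw_min.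
apply: (@win_inj (1 + m%:Z)); [exact: lev_aff | exact: lev_aff |].
by rewrite !win_col //; apply: colw_shape.
Qed.

Lemma roww_uniq w m : is_min_rep w -> row_shape n (Lw w) m -> w = roww (m * n).
Proof.
move=> mw sh; apply: min_rep_uniq => //; first exact: roww_min.
apply: (@win_inj (1 - m%:Z)); [exact: lev_aff | exact: lev_aff |].
by rewrite !win_row //; apply: roww_shape.
Qed.

Lemma colwD a k : colw (a + k * n.+1) = (colw a * colw n.+1 ^+ k)%g.
Proof.
have D b c : colw (b + c * n.+1) = (colw b * colw (c * n.+1))%g.
  elim: b => [|b IH]; first by rewrite mul1g.
  rewrite addSn /= IH mulgA; congr (_ * _ * _)%g.
  by rewrite -(sg_shift n _ c%:Z); congr sg; lia.
rewrite D; congr (_ * _)%g; elim: k => [|k IH]; first by rewrite mul0n expg0.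
by rewrite mulSn D IH expgS.
Qed.

Lemma rowwD a k : roww (a + k * n.+1) = (roww a * roww n.+1 ^+ k)%g.
Proof.
have D b c : roww (b + c * n.+1) = (roww b * roww (c * n.+1))%g.
  elim: b => [|b IH]; first by rewrite mul1g.
  rewrite addSn /= IH mulgA; congr (_ * _ * _)%g.
  by rewrite -(sg_shift n (b%:Z) c%:Z); congr sg; lia.
rewrite D; congr (_ * _)%g; elim: k => [|k IH]; first by rewrite mul0n expg0.
by rewrite mulSn D IH expgS.
Qed.

Lemma spiral_C0 (j : nat) : (0 < j <= n.+1)%N -> spiral_C n 0 j = colw j.
Proof.
rewrite /spiral_C /= big_nil mul1g; case: j => // j /= hj.
elim: j hj => [|j IH] hj; first by rewrite big_nil mul1g sg_nat /= mulg1.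
have -> : (n.+2 - j.+2 = n - j)%N by lia.
rewrite /= big_cons -mulgA -IH; last by lia.
have -> : (n - j).+1 = (n.+2 - j.+1)%N by lia.
congr (_ * _)%g; rewrite sg_nat -(sg_shift n (- _) 1); congr sg; lia.
Qed.

Lemma spiral_C1n : spiral_C n 1 n = colw n.+1.
Proof.
rewrite -spiral_C0; last by lia.
rewrite /spiral_C /= big_seq1 big_nil mul1g.
have -> : (n.+2 - n = 2)%N by lia.
have -> : (n.+2 - n.+1 = 1)%N by lia.
have -> : iota 1 n = 1%N :: iota 2 n.-1 by rewrite -{1}(prednK n_gt0).
by rewrite big_cons.
Qed.

Lemma spiral_Ci1 i : spiral_C n i 1 = roww i.+1.
Proof.
rewrite /spiral_C /= big_nil mulg1; elim: i => [|i IH].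
  by rewrite big_nil mul1g sg_nat /= mulg1.
rewrite -(addn1 i) iotaD rev_cat big_cat /= big_seq1 -mulgA IH addn1 sg_nat /=.
by rewrite add1n.
Qed.

(** Each factor of the power has n + 1 letters, and j + k (n + 1) is congruent to j + k modulo n:
    the divisibility condition says that the number of letters is a multiple of n. *)
Lemma is_spiralP w : is_spiral w <->
  exists2 m, (0 < m)%N & w = colw (m * n) \/ w = roww (m * n).
Proof.
split=> [[]|[m m0 e]].
- move=> [j [k [hj /dvdnP[q eq] ->]]]; rewrite spiral_C0 // spiral_C1n -colwD.
  by exists (q + k)%N; [nia | left; congr colw; nia].
- move=> [i [k [hi /dvdnP[q eq] ->]]]; rewrite !spiral_Ci1 -rowwD.
  by exists (q + k)%N; [nia | right; congr roww; nia].
(* Dividing m n - 1 instead of m n leaves i + 1 letters between 1 and n + 1, so a whole number of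
   turns is written with i = n. *)
have ed := divn_eq (m * n - 1) n.+1; have lm := ltn_pmod (m * n - 1) (ltn0Sn n).
move: (_ %/ _)%N (_ %% _)%N ed lm => k i ed lm.
have mn : (0 < m * n)%N by rewrite muln_gt0 m0.
have ei : (i.+1 + k * n.+1 = m * n)%N by lia.
have dv : (n %| i.+1 + k)%N.
  by apply/dvdnP; exists (m - k)%N; rewrite mulnBl; lia.
case: e => ->; [left | right].
- exists i.+1, k; split; [by lia | by [] |].
  by rewrite spiral_C0; [rewrite spiral_C1n -colwD ei | lia].
exists i, k; split; first by lia.
  by rewrite addnAC addn1.
by rewrite !spiral_Ci1 -rowwD ei.
Qed.

End Spiral.

(** * Closed parabolic orbits *)

Section Cpo.
Variable n : nat.
Hypothesis n_gt0 : (0 < n)%N.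
Local Notation N := (n.+1%:Z).
Local Notation tau := (tau n).
Local Notation sg := (sg n).
Local Notation len := (@affA_length n).
Local Notation Lw := (lev 1).
Implicit Types (L M : int -> int) (w v : affA n) (u : seq 'I_n.+1) (j k p : int).

Lemma bruhat1 w : bruhat_le 1%g w.
Proof.
have [m] := ubnP (len w); elim: m w => // m IH w lem.
have [->|/(len_desc n_gt0)[k dk]] := EM (w = 1%g); first exact: bruhat_refl.
apply: (bruhat_trans (IH (sg k * w)%g _)); first by lia.
by have := @bruhat_up n k (sg k * w)%g; rewrite sgK //; apply.
Qed.

Lemma letter_bruhat u (a : 'I_n.+1) : len (affA_word u) = size u -> a \in u ->
  bruhat_le (sg (a : nat)) (affA_word u).
Proof.
elim: u => // c u IH /=; rewrite word_cons => e.
have l1 := len_sg_le n_gt0 (c : nat) (affA_word u); have l2 := len_word u.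
have up : (len (affA_word u) < len (sg (c : nat) * affA_word u)%g)%N by lia.
rewrite inE => /orP[/eqP ->|au].
  rewrite -{1}[sg _]mulg1; apply: bruhat_lift => //; exact: bruhat1.
by apply: bruhat_trans (bruhat_up up); apply: IH => //; lia.
Qed.

Lemma cpo_desc w k : is_min_rep w -> is_cpo w -> bruhat_le (sg k) w ->
  Lw w (k + 1) <= Lw w k.
Proof.
move=> mw cpo hk; have cL := core_Lw n_gt0 w; rewrite leNgt; apply/negP => lt.
have [a [ea1 ea2]] := sg_ex n_gt0 k; have esa : sg k = affA_gen n a.
  by rewrite sg_nat; apply: sg_eqm.
rewrite esa in hk; move: (cpo _ hk); rewrite -esa => /(coset_leP n_gt0).
rewrite lev_sg // => /(fle_ell n_gt0 (core_tau n_gt0 k cL) cL).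
have := ell_tau n_gt0 k cL.1; rewrite lt ltNge (ltW lt) /=; lia.
Qed.

(** An injection sending length i to the complementary length gives one inequality between
    coefficients; using it at i and at the complementary degree gives equality. *)
Lemma palindromic_invol w p (rv : seq int -> seq int) : is_min_rep w ->
    (forall c d : seq int, size c = n.+1 -> size d = n.+1 -> rv c = rv d -> c = d) ->
    (forall M, core n M -> fle n M (Lw w) -> exists M',
       [/\ core n M', fle n M' (Lw w), (ell n M + ell n M')%N = ell n (Lw w) &
           win n M' p = rv (win n M p)]) ->
  palindromic w.
Proof.
move=> mw rvI H; have lw := (min_repP n_gt0 w).1 mw.
have [v|f hf] := boolp.choice (P := fun (v v' : affA n) => is_min_rep v -> bruhat_le v w ->
   [/\ is_min_rep v', bruhat_le v' w, (len v + len v')%N = len w &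
       win n (Lw v') p = rv (win n (Lw v) p)]).
  have [mv|nv] := EM (is_min_rep v); last by exists v => /nv.
  have [vw|nv] := EM (bruhat_le v w); last by exists v => _ /nv.
  have [M [cM fM lM eM]] := H _ (core_Lw n_gt0 v) (bruhat_fle n_gt0 1 vw).
  have [v' [mv' ev']] := min_rep_ex n_gt0 cM; exists v' => _ _; split=> //.
  - by apply: fle_bruhat => //; rewrite ev'.
  - by rewrite lw -lM -ev' -!(min_repP n_gt0 _).1.
  by rewrite ev'.
have le i : (i <= len w)%N -> (pcount w i <= pcount w (len w - i))%N.
  move=> hi; rewrite {1}/pcount -(size_map f); apply: pcount_ge.
    rewrite map_inj_in_uniq ?filter_uniq ?fset_uniq // => v v'.
    rewrite !mem_filter => /andP[_ /mem_poincare[mv hv]] /andP[_ /mem_poincare[mv' hv']] e.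
    have [_ _ _ e1] := hf v mv hv; have [_ _ _ e2] := hf v' mv' hv'.
    apply: min_rep_uniq => //; apply: (@win_inj n p); [exact: lev_aff | exact: lev_aff |].
    by apply: rvI; rewrite ?size_win // -e1 -e2 e.
  move=> v' /mapP[v]; rewrite mem_filter => /andP[/eqP lv /mem_poincare[mv hv]] ->.
  by have [h1 h2 h3 _] := hf v mv hv; split=> //; lia.
apply/palindromicP => i hi; apply/eqP; rewrite eqn_leq le //=.
by have := le (len w - i)%N (leq_subr _ _); rewrite subKn.
Qed.

Definition bits (s : seq int) := {in s, forall x : int, - 1 <= x <= 0}.

Lemma bits_count s : bits s -> \sum_(x <- s) x = - (count_mem (-1)%R s)%:Z /\
  (count_mem (-1)%R s + count_mem 0%R s)%N = size s.
Proof.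
elim: s => [|x s IH] h; first by rewrite big_nil.
have [] := IH (fun y hy => h y (@mem_behead _ (x :: s) y hy)); rewrite sum_cons /=.
have := h x (mem_head x s) => hx e1 e2.
have [->|->] : x = -1 \/ x = 0 by lia.
  by rewrite e1 /=; split; lia.
by rewrite e1 /=; split; lia.
Qed.

(** On entries -1 and 0, [ells] counts inversions, and a pair of unequal entries is inverted in
    exactly one of s and [rev s]. *)
Lemma bits_rev s : bits s ->
  (ells s + ells (rev s))%N = (count_mem (-1)%R s * count_mem 0%R s)%N.
Proof.
elim: s => [|x s IH] h //; have hs : bits s.
  by move=> y hy; apply: h; rewrite inE hy orbT.
rewrite rev_cons ells_rcons /=.
have E : (\sum_(y <- s) phi x y + \sum_(y <- rev s) phi y x)%N =
    if x == 0 then count_mem (-1)%R s else count_mem 0%R s.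
  have -> : (\sum_(y <- rev s) phi y x = \sum_(y <- s) phi y x)%N.
    by apply: perm_big; rewrite perm_rev.
  rewrite -big_split /=; case: ifP => [/eqP ->|nx]; rewrite -sum1_count [RHS]big_mkcond /=;
    apply: eq_big_seq => y /hs hy.
    by rewrite /phi; case: eqP; do 2!case: ifP; lia.
  have hx := h x (mem_head x s).
  by rewrite /phi; case: eqP; do 2!case: ifP; lia.
have := IH hs; have := h x (mem_head x s) => hx.
have [ex|ex] : x = -1 \/ x = 0 by lia.
  by rewrite ex /= in E *; nia.
by rewrite ex /= in E *; nia.
Qed.

Lemma ells_cat0 s z : bits s -> ells (s ++ nseq z 0) = ells s.
Proof.
move=> h; rewrite ells_cat ells_nseq addn0 big1_seq ?addn0 // => x /andP[_ /h hx].
rewrite big1_seq // => y /andP[_ /nseqP[-> _]]; rewrite /phi; case: ifP; lia.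
Qed.

Lemma floor0 (x : int) : (x %/ N)%Z = 0 -> 0 <= x < N.
Proof.
move=> e; have := divz_eq x N; rewrite e mul0r add0r => ->.
by rewrite modz_ge0 //= ltz_pmod.
Qed.

(** * Cores contained in a rectangle *)

Section Rectangle.
Variables a b : nat.
Hypotheses (a_gt0 : (0 < a)%N) (b_gt0 : (0 < b)%N) (ab : (a + b <= n.+1)%N).

(* The core lies in the rectangle with a rows and b columns. *)
Definition rect M : Prop :=
  (forall j, - a%:Z < j <= b%:Z -> -1 <= M j <= 0) /\
  (forall j, b%:Z < j <= N - a%:Z -> M j = 0).

Lemma rect_win M : rect M -> exists2 s, bits s /\ size s = (a + b)%N &
  win n M (1 - a%:Z) = s ++ nseq (n.+1 - (a + b)) 0.
Proof.
move=> [h1 h2]; exists (seg M (1 - a%:Z) 0 (a + b)).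
  split; last by rewrite size_map size_iota.
  by move=> x /segP[l hl ->]; apply: h1; lia.
rewrite /win -{1}(subnKC ab) iotaD map_cat add0n; congr (_ ++ _).
apply: (@eq_from_nth _ 0) => [|l]; rewrite size_map size_iota ?size_nseq // => hl.
by rewrite (nth_map 0%N) ?size_iota // nth_iota // nth_nseq hl h2 //; lia.
Qed.

Lemma win_rect M s : bits s -> size s = (a + b)%N ->
  win n M (1 - a%:Z) = s ++ nseq (n.+1 - (a + b)) 0 -> rect M.
Proof.
move=> hs sz e.
have H (i : nat) : (i <= n)%N -> M (1 - a%:Z + i%:Z) = nth 0 (s ++ nseq (n.+1 - (a + b)) 0) i.
  by move=> hi; rewrite -e nth_win.
split=> j hj.
  have -> : j = 1 - a%:Z + (absz (j - (1 - a%:Z))%R)%:Z by lia.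
  have lt : (absz (j - (1 - a%:Z))%R < a + b)%N by lia.
  by rewrite H ?nth_cat ?sz ?lt; [apply: hs; rewrite mem_nth ?sz | lia].
have -> : j = 1 - a%:Z + (absz (j - (1 - a%:Z))%R)%:Z by lia.
rewrite H; last by lia.
rewrite nth_cat sz ifF; last by lia.
by rewrite nth_nseq; case: ifP.
Qed.

(** Containment in L forbids M any bead beyond b and any gap up to - a. In windows this reads:
    levels are nonnegative from b + 1 on and nonpositive from 1 - a on. The overlap of the two
    windows gives the zeros, periodicity the lower bound -1. *)
Lemma rect_le L M : core n L -> core n M -> rect L -> fle n M L -> rect M.
Proof.
move=> cL cM [h1 h2] le.
have up : {in win n M (b%:Z + 1), forall x : int, 0 <= x}.
  apply: (@sum0_negp _ id); apply/eqP; rewrite -leqn0.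
  apply: leq_trans (le (b%:Z + 1)) _; rewrite leqn0 /beads; apply/eqP.
  apply: big1_seq => x /andP[_ /mem_win[i hi ->]].
  have [hj|hj] := lerP (b%:Z + 1 + i%:Z) (N - a%:Z); first by rewrite h2 //; lia.
  have h := h1 (b%:Z + 1 + i%:Z + (- 1) * N); rewrite cL.1 in h.
  by rewrite /negp; case: ltP; lia.
have dn : {in win n M (1 - a%:Z), forall x : int, x <= 0}.
  have := beads_gaps (1 - a%:Z) cL; have := beads_gaps (1 - a%:Z) cM.
  have := le (1 - a%:Z).
  have -> : (\sum_(x <- win n L (1 - a%:Z)) negp (- x))%N = 0%N.
    rewrite big1_seq // => x /andP[_ /mem_win[i hi ->]].
    have [hj|hj] := lerP (1 - a%:Z + i%:Z) b%:Z.
      have /andP[_ le0] : - 1 <= L (1 - a%:Z + i%:Z) <= 0 by apply: h1; lia.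
      by rewrite /negp oppr_lt0 ltNge le0.
    by rewrite h2 //; lia.
  move=> e1 e2 e3.
  have /(@sum0_negp _ -%R) h : (\sum_(x <- win n M (1 - a%:Z)) negp (- x))%N = 0%N by lia.
  by move=> x /h; lia.
have dn' j : 1 - a%:Z <= j <= N - a%:Z -> M j <= 0.
  move=> hj; apply: dn; apply/mem_win; exists (absz (j - (1 - a%:Z))%R); first by lia.
  by congr M; lia.
have up' j : b%:Z + 1 <= j <= b%:Z + N -> 0 <= M j.
  move=> hj; apply: up; apply/mem_win; exists (absz (j - (b%:Z + 1))%R); first by lia.
  by congr M; lia.
split=> j hj.
  have := dn' j; have := up' (j + 1 * N); rewrite cM.1; lia.
by have := dn' j; have := up' j; lia.
Qed.

Lemma rect_desc M k : aff n M -> rect M -> M (k + 1) < M k ->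
  exists k', [/\ eqm n k k', - a%:Z < k' & k' < b%:Z].
Proof.
move=> aM [h1 h2] dk; have [i [s e]] := window_ex n k (1 - a%:Z); have hi := ltn_ord i.
exists (1 - a%:Z + i%:Z); split; [by rewrite -e eqm_sym eqm_shift eqmxx | by lia |].
have {}dk : M (1 - a%:Z + i%:Z + 1) < M (1 - a%:Z + i%:Z).
  rewrite -e; have -> : k + s * N + 1 = k + 1 + s * N by lia.
  by rewrite !aM; lia.
rewrite ltNge; apply/negP => hb; move: dk.
have [e1|e1] : i = n :> nat \/ (i < n)%N by lia.
  have -> : 1 - a%:Z + i%:Z + 1 = 1 - a%:Z + 1 * N by lia.
  rewrite aM; have := h1 (1 - a%:Z); have := h1 (1 - a%:Z + i%:Z); have := h2 (1 - a%:Z + i%:Z).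
  by lia.
have := h2 (1 - a%:Z + i%:Z + 1); have := h1 (1 - a%:Z + i%:Z); have := h2 (1 - a%:Z + i%:Z).
by lia.
Qed.

Lemma rect_tau M k : aff n M -> rect M -> - a%:Z < k -> k < b%:Z -> rect (M \o tau k).
Proof.
move=> aM [h1 h2] ka kb; split=> j hj /=.
  have := tau_bound n k j => bd.
  have [->|[->|[n1 n2]]] : j = k \/ (j = k + 1 \/ (j <> k /\ j <> k + 1)) by lia.
  - by rewrite /tau rfl_l; apply: h1; lia.
  - by rewrite /tau rfl_r ?eqmS //; apply: h1; lia.
  by rewrite /tau rflD; [exact: h1 | apply: eqm_neq; lia | apply: eqm_neq; lia].
by rewrite /tau rflD; [exact: h2 | apply: eqm_neq; lia | apply: eqm_neq; lia].
Qed.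

(** A core in the rectangle is built from [base] by swaps at positions between - a and b. At each of
    these L weakly descends, so [fle_tauL] keeps the core below L. *)
Lemma rect_max L M : core n L -> core n M -> fle n (base n) L ->
    (forall k, - a%:Z < k -> k < b%:Z -> L (k + 1) <= L k) -> rect M -> fle n M L.
Proof.
move=> cL + bL dL; have [m] := ubnP (ell n M); elim: m M => // m IH M lem cM rM.
have [->//|/(core_desc n_gt0 cM)[k dk]] := EM (M = base n).
have [k' [ek ka kb]] := rect_desc cM.1 rM dk.
have ed : (ell n (M \o tau k)).+1 = ell n M.
  by have := ell_tau n_gt0 k cM.1; rewrite dk ltNge (ltW dk) /=; lia.
have etau : tau k = tau k' by move/eqmP: ek => [t ->]; rewrite tau_shift.
have -> : M = (M \o tau k) \o tau k'.
  by apply: funext => j; rewrite /= etau tauK.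
apply: fle_tauL => //; [by apply: aff_rfl; exact: cM.1 | exact: cL.1 | | exact: dL].
apply: IH; [by lia | exact: core_tau | by rewrite etau; apply: rect_tau => //; exact: cM.1].
Qed.

Lemma palindromic_rect w : is_min_rep w -> rect (Lw w) ->
    (forall k, - a%:Z < k -> k < b%:Z -> Lw w (k + 1) <= Lw w k) -> palindromic w.
Proof.
move=> mw rw dw; have cL := core_Lw n_gt0 w.
have bL : fle n (base n) (Lw w) by rewrite -(Lw1 n_gt0); apply: bruhat_fle => //; exact: bruhat1.
(* The half turn of the rectangle reverses the a + b entries that describe the boundary path. *)
pose rv (c : seq int) := rev (take (a + b) c) ++ drop (a + b) c.
have H M : core n M -> rect M -> exists M', [/\ core n M', rect M',
    (ell n M + ell n M')%N = (a * b)%N & win n M' (1 - a%:Z) = rv (win n M (1 - a%:Z))].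
  move=> cM rM; have [s [hs sz] ew] := rect_win rM.
  have hs' : bits (rev s) by move=> x; rewrite mem_rev; apply: hs.
  have erv : rv (win n M (1 - a%:Z)) = rev s ++ nseq (n.+1 - (a + b)) 0.
    by rewrite /rv ew -sz take_size_cat // drop_size_cat.
  have szr : size (rv (win n M (1 - a%:Z))) = n.+1.
    by rewrite erv size_cat size_rev size_nseq sz subnKC.
  have S : \sum_(x <- s) x = - a%:Z.
    have := sum_win (1 - a%:Z) cM; rewrite ew big_cat /= [X in _ + X]big1_seq.
      by rewrite addr0 => ->; lia.
    by move=> x /andP[_ /nseqP[-> _]].
  have [c1 c2] := bits_count hs.
  have aM' := Lof_aff n_gt0 (1 - a%:Z) (rv (win n M (1 - a%:Z))).
  exists (Lof n (1 - a%:Z) (rv (win n M (1 - a%:Z)))); split.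
  - apply: core_Lof => //; rewrite erv big_cat /= [X in _ + X]big1_seq.
      by rewrite addr0 (perm_big s) ?perm_rev //= S; lia.
    by move=> x /andP[_ /nseqP[-> _]].
  - by apply: (@win_rect _ (rev s)) => //; rewrite ?size_rev // win_Lof.
  - rewrite -(ell_win (1 - a%:Z) cM.1) -(ell_win (1 - a%:Z) aM') win_Lof // erv ew.
    rewrite !ells_cat0 // bits_rev //.
    have ca : count_mem (-1)%R s = a by lia.
    have cb : count_mem 0%R s = b by lia.
    by rewrite ca cb.
  by rewrite win_Lof.
(* The core of w and its half turn have total length a b, which bounds the length of w above; the
   half turn of [base] has length a b and lies below w. *)
have lw : ell n (Lw w) = (a * b)%N.
  have [M1 [_ _ e1 _]] := H _ cL rw; have rb := rect_le cL (core_base n_gt0) rw bL.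
  have [M' [cM' rM' e _]] := H _ (core_base n_gt0) rb.
  have := fle_ell n_gt0 cM' cL (rect_max cL cM' bL dw rM').
  by move: e; rewrite ell_base //; lia.
apply: (@palindromic_invol w (1 - a%:Z) rv) => // [c d sc sd e|M cM le].
  have st x : size x = n.+1 -> size (rev (take (a + b) x)) = (a + b)%N.
    by move=> sx; rewrite size_rev size_takel // sx.
  move/eqP: e; rewrite /rv eqseq_cat ?st // => /andP[/eqP e1 /eqP e2].
  by rewrite -(cat_take_drop (a + b) c) e2 (can_inj revK e1) cat_take_drop.
have rM := rect_le cL cM rw le; have [M' [h1 h2 h3 h4]] := H M cM rM.
by exists M'; split=> //; [exact: rect_max | rewrite lw].
Qed.

End Rectangle.

Lemma palindromic_cpo w : is_min_rep w -> is_cpo w -> palindromic w.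
Proof.
move=> mw cpo; have [w1|w1] := EM (w = 1%g).
  by apply/palindromicP => i; rewrite w1 len1 leqn0 => /eqP ->.
have [u [eu su]] := len_ex w.
have cL := core_Lw n_gt0 w; have aL := cL.1.
pose inU k := has (fun c : 'I_n.+1 => eqm n (c : nat) k) u.
have nU k : ~~ inU k -> {in u, forall c : 'I_n.+1, eqm n (c : nat) k = false}.
  by move=> /hasPn h c /h /negbTE.
have dU k : inU k -> Lw w (k + 1) <= Lw w k.
  move=> /hasP[c cu ec]; apply: cpo_desc => //.
  by rewrite -(sg_eqm ec) -eu; apply: letter_bruhat => //; rewrite eu.
have inU_shift k t : inU (k + t * N) = inU k.
  by apply: eq_has => c; rewrite eqm_sym eqm_shift eqm_sym.
(* Without the letter s_0 the core would be [base], and w would be 1. *)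
have u0 : inU 0.
  apply: contraT => /nU /lev_avoid; rewrite eu add0r => h; case: w1.
  by apply: len_eq0; rewrite (min_repP n_gt0 w).1 // -(ell_base n_gt0); congr ell; apply: h.
(* If every generator occurred, the levels would be nonincreasing, contrary to the gain of 1 over a
   period. *)
have [b0 nb0] : exists b0 : nat, (b0 <= n)%N && ~~ inU b0%:Z.
  apply: contrapT => h.
  have all k : Lw w (k + 1) <= Lw w k.
    apply: dU; have [i [s e]] := window_ex n k 0; rewrite -(inU_shift k s) e add0r.
    by apply: contraT => ni; case: h; exists (i : nat); rewrite -ltnS ltn_ord.
  have dn (d : nat) : Lw w d%:Z <= Lw w 0.
    elim: d => // d IH; apply: le_trans IH; have := all d%:Z.
    by have -> : d%:Z + 1 = d.+1%:Z by lia.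
  by have := aL 0 1; rewrite add0r mul1r; have := dn n.+1; lia.
have b00 : (0 < b0)%N by case: (posnP b0) nb0 => // ->; rewrite u0 andbF.
(* The sides are the distances q and p from s_0 to the nearest absent generators; b0 is found from
   both sides, which gives p + q <= n + 1. *)
have [|q [qb /andP[q0 nq] hq]] := @first_index (fun i => (0 < i)%N && ~~ inU i%:Z) b0.
  by case/andP: nb0 => _ ->; rewrite b00.
have [|p [pb /andP[p0 np] hp]] := @first_index (fun i => (0 < i)%N && ~~ inU (- i%:Z)) (n.+1 - b0).
  case/andP: nb0 => bn nb; rewrite subn_gt0 ltnS bn /=.
  have -> : - (n.+1 - b0)%N%:Z = b0%:Z + (- 1) * N by lia.
  by rewrite inU_shift.
have pq : (p + q <= n.+1)%N by case/andP: nb0 => bn _; lia.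
(* When s_k is absent, w preserves the block k + 1, ..., k + n + 1; the blocks for q and - p
   together confine the levels to the rectangle. *)
have block k j : ~~ inU k -> k + 1 <= j <= k + N -> k + 1 <= posw w j <= k + N.
  move=> nk hj; have := congr1 (fun F : int -> int => F j) (lev_avoid n_gt0 (nU k nk)).
  rewrite eu /lev /= (@floor_small n (j - _)); last by lia.
  by move=> /floor0; lia.
apply: (@palindromic_rect p q p0 q0 pq w mw).
  split=> j hj.
    have h1 := block q%:Z (j + 1 * N) nq; have h2 := block (- p%:Z) j np.
    rewrite posw_aff // in h1.
    have [h|h] := lerP 1 (posw w j).
      by rewrite /lev floor_small //; lia.
    rewrite /lev; have -> : posw w j - 1 = (- 1) * N + (posw w j - 1 + N) by lia.
    by rewrite divzMDl // floor_small; lia.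
  have h1 := block q%:Z j nq; have h2 := block (- p%:Z) j np.
  by rewrite /lev floor_small //; lia.
move=> k kp kq; apply: dU; have [k0|[k0|k0]] : k = 0 \/ (0 < k \/ k < 0) by lia.
- by rewrite k0.
- have := hq (absz k); have -> : (absz k)%:Z = k by lia.
  by rewrite negb_and negbK => /(_ ltac:(lia)) /orP[|//]; lia.
have := hp (absz k); have -> : - (absz k)%:Z = k by lia.
by rewrite negb_and negbK => /(_ ltac:(lia)) /orP[|//]; lia.
Qed.

Lemma min_rep_below w (i : nat) : is_min_rep w -> (i <= len w)%N ->
  exists v, [/\ is_min_rep v, bruhat_le v w & len v = i].
Proof.
have [m] := ubnP (len w); elim: m w => // m IH w lem mw.
rewrite leq_eqVlt => /orP[/eqP ->|lt]; first by exists w; split=> //; apply: bruhat_refl.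
have [|k [dk mw' lk]] := min_rep_step n_gt0 mw; first by lia.
have [|||v [h1 h2 h3]] := IH (sg k * w)%g; [by lia | by [] | by lia |].
exists v; split=> //; apply: bruhat_trans h2 _.
by have := @bruhat_up n k (sg k * w)%g; rewrite sgK //; apply; lia.
Qed.

End Cpo.

(** The window is x, - x, of length 2 x for x >= 0 and - 2 x - 1 for x < 0, so the length determines
    x. Hence there is at most one minimal representative of each length. *)
Lemma core1_ell L M : core 1 L -> core 1 M -> ell 1 L = ell 1 M -> L = M.
Proof.
move=> cL cM; rewrite /ell /win /= => e; have := cL.2; have := cM.2.
rewrite /win /= !sum_cons !big_nil; move: e; rewrite !big_seq1 !big_nil => e eM eL.
have H : forall x y x' y' : int, phi x y = phi x' y' -> x + y = 0 -> x' + y' = 0 -> x = x' /\ y = y'.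
  by move=> x y x' y'; rewrite /phi; do 2!case: ifP; lia.
rewrite !addn0 in e; have [||e1 e2] := H _ _ _ _ e; [by lia | by lia |].
 apply: (aff_eq_win (j := 1) cL.1 cM.1) => -[|[|i]] //.
Qed.

Lemma palindromic1 (w : affA 1) : is_min_rep w -> palindromic w.
Proof.
move=> mw; have n0 : (0 < 1)%N by [].
suff E i : (i <= affA_length w)%N -> pcount w i = 1%N.
  by apply/palindromicP => i hi; rewrite !E // leq_subr.
move=> hi; have [v [mv vw lv]] := min_rep_below n0 mw hi.
apply/eqP; rewrite eqn_leq; apply/andP; split.
  apply: (@pcount_le 1 w i [:: v]) => v' mv' _ lv'; rewrite inE; apply/eqP.
  apply: min_rep_uniq => //; apply: core1_ell; try exact: core_Lw.
  by rewrite -!(min_repP n0 _).1 // lv lv'.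
apply: (@pcount_ge 1 w i [:: v]) => // v'; rewrite inE => /eqP -> //.
Qed.

Local Close Scope ring_scope.

Theorem theorem9p16 (n : nat) :
  (n = 1 -> forall w : affA n, is_min_rep w -> palindromic w) /\
  (2 <= n -> forall w : affA n, is_min_rep w ->
     (palindromic w <-> is_cpo w \/ is_spiral w)).
Proof.
split=> [->|n1 w mw]; first exact: palindromic1.
have n0 := ltnW n1; split=> [pal|[cpo|/(is_spiralP n0)[m m0 [e|e]]]].
- have [|[m m0 [sh|sh]]] := palindromic_shape n1 mw pal; [by left | |];
    right; apply/(is_spiralP n0); exists m => //.
    by right; apply: roww_uniq.
  by left; apply: colw_uniq.
- exact: palindromic_cpo.
- by apply: (@palindromic_col n n0 w m mw); rewrite e; apply: colw_shape.
by apply: (@palindromic_row n n0 w m mw); rewrite e; apply: roww_shape.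
Qed.
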